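(* Let $R$ be a local $F$-finite Gorenstein ring of prime characteristic $p$ and let $Q\subseteq R$ be an ideal of finite projective dimension. Then for every $e > 0$, any map $\phi\in\operatorname{Hom}_{R/Q}(F^e_*(R/Q),R/Q)$ lifts to a map $\widetilde{\phi}\in\operatorname{Hom}_R(F^e_*R,R)$.
   Context: All rings are commutative, Noetherian, with unity, of prime characteristic $p>0$. $F^e_*R$ denotes $R$ viewed as an $R$-module via the $e$-th iterate of Frobenius; its elements are written $F^e_*r$. $R$ is $F$-finite if $F^e_*R$ is a finite $R$-module. An ideal $Q$ has finite projective dimension if $\operatorname{pd}_R(R/Q)<\infty$. That $\widetilde{\phi}$ lifts $\phi$ means that $\pi\circ\widetilde{\phi}=\phi\circ F^e_*\pi$, where $\pi:R\to R/Q$ is the quotient map and $F^e_*\pi:F^e_*R\to F^e_*(R/Q)$ is the induced map. *)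

(* Defs.v *)
From HB Require Import structures.
From mathcomp Require Import all_boot all_order all_algebra.

Set Implicit Arguments.
Unset Strict Implicit.
Unset Printing Implicit Defensive.

Import GRing.Theory.
Local Open Scope ring_scope.
Local Open Scope quotient_scope.

(* Ideals are submodules of the regular module; the unit ideal is allowed.    *)
(* Submodules are bool-valued predicates, which under the classical axioms of *)
(* mathcomp.classical.boolp are the same as arbitrary subsets; likewise every *)
(* type then carries a choiceType structure, so that quantifying over         *)
(* [lmodType R] is quantifying over all modules.                              *)
Notation ideal R := (submodClosed R^o).

(* The quotient ring R/I. The library's {ideal_quot I} requires 1 \notin I;   *)
(* here I may be the unit ideal, so R/I is only a comPzRingType.              *)
Section IdealQuotient.
Variables (R : comPzRingType) (I : ideal R).

Lemma ideal_zmod_closed : zmod_closed (I : {pred R}).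
Proof. exact: GRing.submod_closedB (GRing.submodClosedP I). Qed.

Definition ideal_zmodClosed : zmodClosed R :=
  HB.pack (I : {pred R})
    (GRing.isZmodClosed.Build R (I : {pred R}) ideal_zmod_closed).

Definition ideal_quotient : Type := Quotient.quot ideal_zmodClosed.

HB.instance Definition _ := GRing.Zmodule.on ideal_quotient.

Definition quot_map (x : R) : ideal_quotient :=
  \pi_(Quotient.quot ideal_zmodClosed) x.

Lemma quot_map_eq x y : (quot_map x == quot_map y) = (x - y \in I).
Proof. by rewrite /quot_map -Quotient.idealrBE. Qed.

Lemma quot_map_repr (x : ideal_quotient) :
  quot_map (repr (x : Quotient.quot ideal_zmodClosed)) = x.
Proof. exact: reprK. Qed.

Lemma quot_map_surj (x : ideal_quotient) : exists r, quot_map r = x.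
Proof. by exists (repr (x : Quotient.quot ideal_zmodClosed)); exact: reprK. Qed.

Lemma quot_map_is_zmod_morphism : zmod_morphism quot_map.
Proof. by move=> x y; rewrite /quot_map raddfB. Qed.

HB.instance Definition _ :=
  GRing.isZmodMorphism.Build R ideal_quotient quot_map
    quot_map_is_zmod_morphism.

Definition quot_one : ideal_quotient := quot_map 1.
Definition quot_mul (x y : ideal_quotient) : ideal_quotient :=
  quot_map (repr (x : Quotient.quot ideal_zmodClosed)
            * repr (y : Quotient.quot ideal_zmodClosed)).

Lemma quot_map_mul : {morph quot_map : x y / x * y >-> quot_mul x y}.
Proof.
move=> x y; apply/eqP; rewrite /quot_mul quot_map_eq.
set x' := repr _; set y' := repr _.
have hx : x - x' \in I by rewrite -quot_map_eq quot_map_repr.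
have hy : y - y' \in I by rewrite -quot_map_eq quot_map_repr.
suff -> : x * y - x' * y' = y *: (x - x' : R^o) + x' *: (y - y' : R^o) :> R^o.
  exact: (@rpredD R^o I _ _ (@rpredZ _ R^o I y _ hx) (@rpredZ _ R^o I x' _ hy)).
rewrite /GRing.scale /= !mulrBr addrA (mulrC y x) (mulrC y x').
by rewrite subrK.
Qed.

Lemma quot_mulA : associative quot_mul.
Proof.
move=> x y z; have [a <-] := quot_map_surj x; have [b <-] := quot_map_surj y.
by have [c <-] := quot_map_surj z; rewrite -!quot_map_mul mulrA.
Qed.

Lemma quot_mulC : commutative quot_mul.
Proof.
move=> x y; have [a <-] := quot_map_surj x; have [b <-] := quot_map_surj y.
by rewrite -!quot_map_mul mulrC.
Qed.

Lemma quot_mul1 : left_id quot_one quot_mul.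
Proof.
by move=> x; have [a <-] := quot_map_surj x; rewrite -quot_map_mul mul1r.
Qed.

Lemma quot_mulDl : left_distributive quot_mul +%R.
Proof.
move=> x y z; have [a <-] := quot_map_surj x; have [b <-] := quot_map_surj y.
have [c <-] := quot_map_surj z.
by rewrite -raddfD -!quot_map_mul -raddfD mulrDl.
Qed.

HB.instance Definition _ :=
  GRing.Zmodule_isComPzRing.Build ideal_quotient
    quot_mulA quot_mulC quot_mul1 quot_mulDl.

Lemma quot_map_is_monoid_morphism : monoid_morphism quot_map.
Proof. by split=> // x y; rewrite quot_map_mul. Qed.

HB.instance Definition _ :=
  GRing.isMonoidMorphism.Build R ideal_quotient quot_map
    quot_map_is_monoid_morphism.

Definition quot_scale (r : R) (x : ideal_quotient) : ideal_quotient :=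
  quot_map r * x.

Lemma quot_scaleA a b x : quot_scale a (quot_scale b x) = quot_scale (a * b) x.
Proof. by rewrite /quot_scale rmorphM mulrA. Qed.

Lemma quot_scale1 : left_id 1 quot_scale.
Proof. by move=> x; rewrite /quot_scale rmorph1 mul1r. Qed.

Lemma quot_scaleDr : right_distributive quot_scale +%R.
Proof. by move=> a x y; rewrite /quot_scale mulrDr. Qed.

Lemma quot_scaleDl x : {morph quot_scale^~ x : a b / a + b}.
Proof. by move=> a b; rewrite /quot_scale rmorphD mulrDl. Qed.

HB.instance Definition _ :=
  GRing.Zmodule_isLmodule.Build R ideal_quotient
    quot_scaleA quot_scale1 quot_scaleDr quot_scaleDl.

End IdealQuotient.

(* For a nonzero ring this is p \in [pchar S], which the library defines only *)
(* for nzSemiRingType.                                                        *)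
Definition prime_char (p : nat) (S : pzSemiRingType) : bool :=
  prime p && (p%:R == 0 :> S).

Lemma prime_charE (p : nat) (R : nzSemiRingType) :
  prime_char p R = (p \in [pchar R]).
Proof. by []. Qed.

Lemma quot_prime_char (p : nat) (R : comPzRingType) (I : ideal R) :
  prime_char p R -> prime_char p (ideal_quotient I).
Proof.
case/andP=> pp /eqP p0; apply/andP; split=> //.
by rewrite -(rmorph_nat (@quot_map _ I)) p0 rmorph0.
Qed.

(* F^e_* S: the elements of S, with r acting as multiplication by r ^ (p ^ e). *)
Definition frobenius_pushforward (p : nat) (S : comPzRingType)
  (charS : prime_char p S) (e : nat) : Type := S.

Section FrobeniusPushforward.
Variables (p : nat) (S : comPzRingType) (charS : prime_char p S) (e : nat).
Local Notation FeS := (frobenius_pushforward charS e).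

HB.instance Definition _ := GRing.Zmodule.on FeS.

Lemma exprDn_prime_char (x y : S) :
  (x + y) ^+ (p ^ e) = x ^+ (p ^ e) + y ^+ (p ^ e).
Proof.
have [p_pr /eqP p0] := andP charS.
elim: e => [|k IHk]; first by rewrite !expr1.
rewrite expnSr !exprM {}IHk; move: (x ^+ _) (y ^+ _) => {}x {}y.
have p_gt0 := prime_gt0 p_pr.
rewrite exprDn -(prednK p_gt0) big_ord_recr big_ord_recl /= prednK //.
rewrite subn0 subnn bin0 binn !mulr1n expr0 mulr1 mul1r.
rewrite big1 ?addr0 // => i _.
have /dvdnP[m ->] : (p %| 'C(p, bump 0 i))%N.
  rewrite prime_dvd_bin // /bump /= add1n.
  by rewrite -[X in (_ < X)%N](prednK p_gt0) ltnS ltn_ord.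
by rewrite -mulr_natr natrM p0 !mulr0.
Qed.

Definition frobenius_scale (r : S) (x : FeS) : FeS :=
  (r ^+ (p ^ e) * (x : S)) : S.

Lemma frobenius_scaleA a b x :
  frobenius_scale a (frobenius_scale b x) = frobenius_scale (a * b) x.
Proof. by rewrite /frobenius_scale exprMn mulrA. Qed.

Lemma frobenius_scale1 : left_id 1 frobenius_scale.
Proof. by move=> x; rewrite /frobenius_scale expr1n mul1r. Qed.

Lemma frobenius_scaleDr : right_distributive frobenius_scale +%R.
Proof. by move=> a x y; exact: mulrDr. Qed.

Lemma frobenius_scaleDl x : {morph frobenius_scale^~ x : a b / a + b}.
Proof.
by move=> a b; rewrite /frobenius_scale exprDn_prime_char; exact: mulrDl.
Qed.

HB.instance Definition _ :=
  GRing.Zmodule_isLmodule.Build S FeS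
    frobenius_scaleA frobenius_scale1 frobenius_scaleDr frobenius_scaleDl.

End FrobeniusPushforward.

(* F^e_* f : F^e_* S -> F^e_* T is f itself on elements. *)
Definition frobenius_map (p : nat) (S T : comPzRingType)
    (charS : prime_char p S) (charT : prime_char p T) (e : nat)
    (f : {rmorphism S -> T}) :
    frobenius_pushforward charS e -> frobenius_pushforward charT e :=
  f.
Arguments frobenius_map {p S T} charS charT e f x.

Section Modules.
Variable R : comPzRingType.

Definition finite_module (M : lmodType R) : Prop :=
  exists (n : nat) (g : 'I_n -> M),
    forall x, exists c : 'I_n -> R, x = \sum_i c i *: g i.

Definition exact (U V W : lmodType R) (f : {linear U -> V})
    (g : {linear V -> W}) : Prop :=
  forall v, g v = 0 <-> exists u, f u = v.

Definition zero_module (M : lmodType R) : Prop := forall x : M, x = 0.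

Definition projective (P : lmodType R) : Prop :=
  forall (A B : lmodType R) (f : {linear A -> B}) (g : {linear P -> B}),
    (forall b, exists a, f a = b) ->
    exists h : {linear P -> A}, forall x, f (h x) = g x.

Definition injective_module (E : lmodType R) : Prop :=
  forall (A B : lmodType R) (f : {linear A -> B}) (g : {linear A -> E}),
    injective f ->
    exists h : {linear B -> E}, forall x, h (f x) = g x.

(* There is an exact sequence 0 -> P_n -> ... -> P_0 -> M -> 0 with all P_i   *)
(* projective; it is padded with zero modules beyond P_n.                     *)
Definition finite_projective_dimension (M : lmodType R) : Prop :=
  exists (n : nat) (P : nat -> lmodType R)
      (d : forall i, {linear P i.+1 -> P i}) (aug : {linear P 0%N -> M}),
    [/\ forall i, projective (P i),
        forall i, (n < i)%N -> zero_module (P i),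
        forall x, exists u, aug u = x,
        exact (d 0%N) aug
      & forall i, exact (d i.+1) (d i)].

(* Dually, 0 -> M -> E^0 -> ... -> E^n -> 0 with all E^i injective. *)
Definition finite_injective_dimension (M : lmodType R) : Prop :=
  exists (n : nat) (E : nat -> lmodType R)
      (d : forall i, {linear E i -> E i.+1}) (coaug : {linear M -> E 0%N}),
    [/\ forall i, injective_module (E i),
        forall i, (n < i)%N -> zero_module (E i),
        injective coaug,
        exact coaug (d 0%N)
      & forall i, exact (d i) (d i.+1)].

End Modules.

Section Rings.
Variable R : comPzRingType.

Definition noetherian : Prop :=
  forall I : ideal R, exists (n : nat) (g : 'I_n -> R),
    forall x, x \in I <-> exists c : 'I_n -> R, x = \sum_i c i * g i.

Definition maximal_ideal (m : ideal R) : Prop :=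
  1 \notin m /\
  forall J : ideal R, {subset m <= J} -> 1 \notin J -> {subset J <= m}.

Definition local_ring : Prop :=
  exists m : ideal R,
    maximal_ideal m /\ forall m' : ideal R, maximal_ideal m' -> m' =i m.

Definition gorenstein_local_ring : Prop :=
  [/\ noetherian, local_ring & finite_injective_dimension R^o].

(* Finiteness of F^e_* R for one e > 0 is equivalent to finiteness for all e. *)
Definition F_finite (p : nat) (charR : prime_char p R) : Prop :=
  exists2 e : nat, (0 < e)%N & finite_module (frobenius_pushforward charR e).

End Rings.

(* Main.v *)
Require Import Defs.
From HB Require Import structures.
From mathcomp Require Import all_boot all_order all_algebra.
From mathcomp Require Import boolp functions.

Set Implicit Arguments.
Unset Strict Implicit.
Unset Printing Implicit Defensive.

Import GRing.Theory.
Local Open Scope ring_scope.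

(** Write F for F^e_* R and q for p ^ e. Composing phi with the projection of F
    onto F^e_* (R/Q) gives an R-linear map F -> R/Q, and the task is to lift it
    through R -> R/Q. Three facts make this possible.

    First, Ext^i(F, R) = 0 for all i > 0 ([ext_vanishes_frobenius]). This is the
    vanishing of Ext from a maximal Cohen-Macaulay module into a ring of finite
    injective dimension, and F is as deep as R because x acts on F as x ^ q acts
    on R. Ext is computed with the given injective resolution of R. Let n be
    least such that Ext^i(N, R) = 0 for all finitely generated N and all i > n,
    and suppose n > 0. Then Ext^n(k, R) is nonzero for the residue field k: by
    Noetherian induction and Nakayama, its vanishing would propagate to all
    finitely generated modules ([ext_vanishes_residue]). Suppose moreover that
    Ext^s(F, R) is nonzero for some s > 0. Starting with I = 0, add elements to
    an ideal I so that after j steps Ext^i(R/I, R) = 0 for i > j while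
    Ext^(s+j)(F/F^e_* I, R) is nonzero. As long as j < n the residue field does
    not embed in R/I, since Ext^n is right exact, so some x in the maximal ideal
    is regular on R/I ([exists_regular_element]). Then x ^ q is regular on R/I,
    which says that x is regular on F/F^e_* I, and I + x ^ q R is the next
    ideal. After n steps Ext^(s+n)(F/F^e_* I, R) is nonzero, against the choice
    of n.

    Secondly, Ext^1(M, R) = 0 says that maps from a syzygy of M to R extend to
    the covering projective module; with a dual basis this passes from R to an
    arbitrary projective target ([extend_to_projective]).

    Thirdly, these extensions let a map F -> R/Q be lifted to P_0 for a finite
    projective resolution P of R/Q, by descending induction along P
    ([lift_through_resolution]). Finally P_0 -> R/Q factors through R -> R/Q
    because P_0 is projective. *)

(** * Submodules and quotient modules *)

Section Submodule.
Variables (R : comPzRingType) (M : lmodType R).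

Section Build.
Variables (P : M -> Prop) (P0 : P 0).
Hypothesis (PD : forall a x y, P x -> P y -> P (a *: x + y)).

Lemma asbool_submod_closed : submod_closed (fun x => `[< P x >]).
Proof.
split; first exact/asboolP.
by move=> a x y /asboolP Px /asboolP Py; apply/asboolP; exact: PD.
Qed.

Definition submod_of : submodClosed M :=
  HB.pack (fun x => `[< P x >])
    (GRing.isSubmodClosed.Build R M (fun x => `[< P x >])
       asbool_submod_closed).

Lemma mem_submod_of x : x \in submod_of <-> P x.
Proof. by split=> [/asboolP|? ]; last exact/asboolP. Qed.
End Build.

Variable N : submodClosed M.

Lemma submod_lin a x y : x \in N -> y \in N -> a *: x + y \in N.
Proof. by move=> Nx Ny; apply: rpredD => //; exact: rpredZ. Qed.

Lemma submodB x y : x \in N -> y \in N -> x - y \in N.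
Proof. by move=> Nx Ny; rewrite addrC -scaleN1r; exact: submod_lin. Qed.

Record submodule := Submodule { submodule_val :> M; _ : submodule_val \in N }.
HB.instance Definition _ := [isSub for submodule_val].
HB.instance Definition _ := [Choice of submodule by <:].
HB.instance Definition _ := [SubChoice_isSubLmodule of submodule by <:].

Definition sub_incl : {linear submodule -> M} := \val.

Lemma sub_incl_inj : injective sub_incl. Proof. exact: val_inj. Qed.
Lemma sub_incl_mem x : sub_incl x \in N. Proof. exact: valP. Qed.
Lemma sub_incl_surj x : x \in N -> exists y, sub_incl y = x.
Proof. by move=> Nx; exists (Submodule Nx). Qed.

Definition quot_zmodClosed : zmodClosed M :=
  HB.pack (N : {pred M})
    (GRing.isZmodClosed.Build M (N : {pred M})
       (GRing.submod_closedB (GRing.submodClosedP N))).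

Definition quot_module : Type := Quotient.quot quot_zmodClosed.
HB.instance Definition _ := GRing.Zmodule.on quot_module.

Definition quot_pi (x : M) : quot_module :=
  (\pi_(Quotient.quot quot_zmodClosed) x)%qT.
Let rep (x : quot_module) : M := repr (x : Quotient.quot quot_zmodClosed).

Let quot_pi_eq x y : (quot_pi x == quot_pi y) = (x - y \in N).
Proof. by rewrite /quot_pi -Quotient.idealrBE. Qed.

Let repK x : quot_pi (rep x) = x. Proof. exact: reprK. Qed.

Let quot_pi_zmod : zmod_morphism quot_pi.
Proof. by move=> x y; rewrite /quot_pi raddfB. Qed.

Definition quot_module_scale a (x : quot_module) : quot_module :=
  quot_pi (a *: rep x).

Let scale_pi a x : quot_module_scale a (quot_pi x) = quot_pi (a *: x).
Proof.
apply/eqP; rewrite quot_pi_eq -scalerBr; apply: rpredZ.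
by rewrite -quot_pi_eq repK.
Qed.

Let scaleA a b x :
  quot_module_scale a (quot_module_scale b x) = quot_module_scale (a * b) x.
Proof. by rewrite -[x]repK !scale_pi scalerA. Qed.
Let scale1 : left_id 1 quot_module_scale.
Proof. by move=> x; rewrite -[x]repK !scale_pi scale1r. Qed.
Let scaleDr : right_distributive quot_module_scale +%R.
Proof.
have pD x y : quot_pi x + quot_pi y = quot_pi (x + y).
  by rewrite /quot_pi raddfD.
by move=> a x y; rewrite -[x]repK -[y]repK pD !scale_pi pD scalerDr.
Qed.
Let scaleDl x : {morph quot_module_scale^~ x : a b / a + b}.
Proof.
have pD y z : quot_pi y + quot_pi z = quot_pi (y + z).
  by rewrite /quot_pi raddfD.
by move=> a b; rewrite -[x]repK !scale_pi pD scalerDl.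
Qed.
HB.instance Definition _ :=
  GRing.Zmodule_isLmodule.Build R quot_module scaleA scale1 scaleDr scaleDl.

HB.instance Definition _ :=
  GRing.isZmodMorphism.Build M quot_module quot_pi quot_pi_zmod.
HB.instance Definition _ :=
  GRing.isScalable.Build R M quot_module *:%R quot_pi
    (fun a x => esym (scale_pi a x)).

Definition quot_proj : {linear M -> quot_module} := quot_pi.

Lemma quot_proj_surj y : exists x, quot_proj x = y.
Proof. by exists (rep y); exact: repK. Qed.

Lemma quot_proj_eq0 x : quot_proj x = 0 <-> x \in N.
Proof.
rewrite -[x in x \in _]subr0 -quot_pi_eq [quot_pi 0](linear0 quot_proj).
by split=> [/eqP|/eqP].
Qed.

End Submodule.
Arguments sub_incl {R M N}.
Arguments quot_proj {R M}.

(** * Linear maps and exact sequences *)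

Definition surjective A B (f : A -> B) := forall y, exists x, f x = y.

Section LinearMaps.
Variable R : comPzRingType.
Implicit Types A B C P M : lmodType R.

Lemma linear_ex A B (f : A -> B) :
  linear f -> exists g : {linear A -> B}, forall x, g x = f x.
Proof.
move=> lf; pose F : {linear A -> B} :=
  HB.pack f (GRing.isLinear.Build R A B *:%R f lf).
by exists F.
Qed.

Lemma factor_surj A B C (g : {linear A -> B}) (h : {linear A -> C}) :
    surjective g -> (forall x, g x = 0 -> h x = 0) ->
  exists k : {linear B -> C}, forall x, k (g x) = h x.
Proof.
move=> gs hg; have [r rK] := choice gs.
have hrg x : h (r (g x)) = h x.
  by apply/eqP; rewrite -subr_eq0 -linearB hg // linearB rK subrr.
have [k kE] : exists k : {linear B -> C}, forall x, k x = h (r x).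
  apply: linear_ex => a x y; rewrite -linearP -hrg [in LHS]rK.
  by rewrite -[LHS]hrg -[RHS]hrg linearP !rK.
by exists k => x; rewrite kE hrg.
Qed.

Lemma factor_inj A B C (i : {linear A -> B}) (h : {linear C -> B}) :
    injective i -> (forall x, exists y, i y = h x) ->
  exists k : {linear C -> A}, forall x, i (k x) = h x.
Proof.
move=> ii hi; have [k kE] := choice hi.
have [k' k'E] : exists k' : {linear C -> A}, forall x, k' x = k x.
  by apply: linear_ex => a x y; apply: ii; rewrite linearP !kE linearP.
by exists k' => x; rewrite k'E.
Qed.

Lemma kernel_lin A B (g : {linear A -> B}) a x y :
  g x = 0 -> g y = 0 -> g (a *: x + y) = 0.
Proof. by move=> gx gy; rewrite linearP gx gy scaler0 addr0. Qed.

Definition kernel A B (g : {linear A -> B}) : submodClosed A :=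
  submod_of (linear0 g) (@kernel_lin A B g).

Lemma mem_kernel A B (g : {linear A -> B}) x : x \in kernel g <-> g x = 0.
Proof. exact: mem_submod_of. Qed.

(** The projectivity axiom asks for a surjection; here exactness makes f a
    surjection onto the kernel of g. *)
Lemma projective_lift P A B C (f : {linear A -> B}) (g : {linear B -> C})
    (h : {linear P -> B}) :
    projective P -> exact f g -> (forall x, g (h x) = 0) ->
  exists k : {linear P -> A}, forall x, f (k x) = h x.
Proof.
move=> Pp fg gh.
have [h' h'E] : exists h' : {linear P -> submodule (kernel g)},
    forall x, sub_incl (h' x) = h x.
  apply: factor_inj => [|x]; first exact: sub_incl_inj.
  by apply: sub_incl_surj; apply/mem_kernel.
have [f' f'E] : exists f' : {linear A -> submodule (kernel g)},
    forall x, sub_incl (f' x) = f x.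
  apply: factor_inj => [|x]; first exact: sub_incl_inj.
  by apply: sub_incl_surj; apply/mem_kernel/fg; exists x.
have [y|k kE] := Pp _ _ f' h'.
  have /mem_kernel/fg[x fx] := sub_incl_mem y.
  by exists x; apply: sub_incl_inj; rewrite f'E.
by exists k => x; rewrite -f'E kE h'E.
Qed.

Definition short_exact A B C (f : {linear A -> B}) (g : {linear B -> C}) :=
  [/\ injective f, exact f g & surjective g].

Lemma linear_inj A B (f : {linear A -> B}) :
  (forall x, f x = 0 -> x = 0) -> injective f.
Proof.
by move=> fi x y fxy; apply/subr0_eq/fi; rewrite linearB fxy subrr.
Qed.

Lemma short_exact_kernel A B (g : {linear A -> B}) :
  surjective g -> short_exact (@sub_incl R A (kernel g)) g.
Proof.
move=> gs; split=> //.
move=> x; split=> [/mem_kernel/sub_incl_surj//|[y <-]].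
by apply/mem_kernel; exact: sub_incl_mem.
Qed.

End LinearMaps.

(** * Finitely generated modules over a Noetherian ring *)

Section FiniteGeneration.
Variable R : comPzRingType.
Implicit Types M : lmodType R.

(** The span is defined by recursion on the generators, one coefficient at a
    time, so that inductions on the number of generators avoid indexed sums. *)
Fixpoint in_span M (s : seq M) (x : M) : Prop :=
  if s is a :: s' then exists c : R, in_span s' (x - c *: a) else x = 0.

Lemma in_span_lin M (s : seq M) a x y :
  in_span s x -> in_span s y -> in_span s (a *: x + y).
Proof.
elim: s x y => /= [|b s IHs] x y; first by move=> -> ->; rewrite scaler0 addr0.
move=> [c sc] [d sd]; exists (a * c + d).
have -> : a *: x + y - (a * c + d) *: b = a *: (x - c *: b) + (y - d *: b).
  by rewrite scalerBr scalerA scalerDl opprD addrACA.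
exact: IHs.
Qed.

Lemma in_span0 M (s : seq M) : in_span s 0.
Proof. by elim: s => //= a s IHs; exists 0; rewrite scale0r subr0. Qed.

Lemma in_span_cons M (s : seq M) a x : in_span s x -> in_span (a :: s) x.
Proof. by move=> sx; exists 0; rewrite scale0r subr0. Qed.

Lemma in_span_mem M (s : seq M) a : a \in s -> in_span s a.
Proof.
elim: s => //= b s IHs; rewrite inE => /predU1P[->|/IHs sa].
  by exists 1; rewrite scale1r subrr; exact: in_span0.
exact: (in_span_cons b sa).
Qed.

Definition span_submod M (s : seq M) : submodClosed M :=
  submod_of (in_span0 s) (@in_span_lin M s).

Lemma mem_span_submod M (s : seq M) x : x \in span_submod s <-> in_span s x.
Proof. exact: mem_submod_of. Qed.

Lemma in_span_min M (s : seq M) (N : submodClosed M) x :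
  {subset s <= N} -> in_span s x -> x \in N.
Proof.
elim: s x => /= [|a s IHs] x sN; first by move=> ->; exact: rpred0.
case=> c /IHs Nx; rewrite -(subrK (c *: a) x) rpredD //.
  by apply: Nx => b bs; apply: sN; rewrite inE bs orbT.
by apply: rpredZ; apply: sN; rewrite mem_head.
Qed.

Lemma in_span_sub M (s t : seq M) x :
  (forall a, a \in s -> in_span t a) -> in_span s x -> in_span t x.
Proof.
move=> st sx; apply/mem_span_submod; apply: in_span_min sx => a /st ta.
exact/mem_span_submod.
Qed.

Lemma in_span_linear M M' (f : {linear M -> M'}) s x :
  in_span s x -> in_span (map f s) (f x).
Proof.
elim: s x => /= [|a s IHs] x; first by move=> ->; rewrite linear0.
by case=> c /IHs; rewrite linearB linearZ; exists c.
Qed.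

Lemma in_span_sum M n (g : 'I_n -> M) (c : 'I_n -> R) :
  in_span (codom g) (\sum_i c i *: g i).
Proof.
apply/mem_span_submod; apply: rpred_sum => i _; apply: rpredZ.
by apply/mem_span_submod/in_span_mem/codom_f.
Qed.

Definition finitely_generated M := exists s : seq M, forall x, in_span s x.

Lemma finite_module_fg M : finite_module M -> finitely_generated M.
Proof.
move=> [n [g gM]]; exists (codom g) => x; have [c ->] := gM x.
exact: in_span_sum.
Qed.

Lemma fg_surj M M' (f : {linear M -> M'}) :
  surjective f -> finitely_generated M -> finitely_generated M'.
Proof.
move=> fs [s sM]; exists (map f s) => y; have [x <-] := fs y.
exact: in_span_linear.
Qed.

Lemma fg_regular : finitely_generated (R^o : lmodType R).
Proof.
exists [:: 1] => x; exists x => /=.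
by apply/eqP; rewrite subr_eq0 /GRing.scale /= mulr1.
Qed.

Lemma noetherian_ideal_fg (I : ideal R) : noetherian R ->
  exists2 s : seq R^o, {subset s <= I} & forall x, x \in I -> in_span s x.
Proof.
move=> /(_ I)[n [g gI]]; exists (codom (g : 'I_n -> R^o)).
  move=> _ /codomP[i ->]; apply/gI; exists (fun j => (j == i)%:R).
  rewrite (bigD1 i) //= eqxx mul1r big1 ?addr0 // => j /negbTE->.
  by rewrite mul0r.
by move=> x /gI[c ->]; exact: (@in_span_sum R^o).
Qed.

(** By induction on the length of s: the coefficients that elements of N can
    have at the first generator form an ideal, which is finitely generated, and
    what remains of N lies in the span of the other generators. *)
Lemma noetherian_submod_fg M (s : seq M) (N : submodClosed M) : noetherian R ->
    (forall x, x \in N -> in_span s x) ->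
  exists2 t : seq M, {subset t <= N} & forall x, x \in N -> in_span t x.
Proof.
move=> nR; elim: s N => [|a s IHs] N Ns.
  by exists [::] => //.
pose P (r : R^o) := exists2 x, x \in N & in_span s (x - r *: a).
have P0 : P 0 by exists 0; rewrite ?rpred0 // scale0r subr0; exact: in_span0.
have PD b r r' : P r -> P r' -> P (b *: r + r').
  move=> [x Nx sx] [y Ny sy]; exists (b *: x + y); first exact: submod_lin.
  have -> : b *: x + y - (b *: r + r') *: a
      = b *: (x - r *: a) + (y - r' *: a).
    by rewrite scalerBr scalerA scalerDl opprD addrACA.
  exact: in_span_lin.
have [u uP Pu] := noetherian_ideal_fg (submod_of P0 PD) nR.
(* v lifts to N a list of generators of the ideal of leading coefficients. *)
have [v vN uv] : exists2 v : seq M, {subset v <= N} & forall r, in_span u r ->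
    exists2 x, in_span v x & in_span s (x - r *: a).
  elim: u {Pu} uP => [|r u IHu] uP.
    exists [::] => // r /= ->; exists 0 => //.
    by rewrite scale0r subr0; exact: in_span0.
  have /mem_submod_of[x Nx sx] := uP _ (mem_head r u).
  have [w wu|v vN uv] := IHu; first by apply: uP; rewrite inE wu orbT.
  exists (x :: v) => [y|r' /= [c /uv[y vy sy]]].
    by rewrite inE => /predU1P[->|/vN].
  exists (c *: x + y).
    by exists c; rewrite addrAC subrr add0r.
  have -> : c *: x + y - r' *: a
      = c *: (x - r *: a) + (y - (r' - c *: r) *: a).
    by rewrite scalerBr scalerBl opprB scalerA -[c *: r]/(c * r) addrACA addKr.
  exact: in_span_lin.
pose Q x := x \in N /\ in_span s x.
have Q0 : Q 0 by split; [exact: rpred0|exact: in_span0].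
have QD b x y : Q x -> Q y -> Q (b *: x + y).
  by move=> [Nx sx] [Ny sy]; split; [exact: submod_lin|exact: in_span_lin].
have [x /mem_submod_of[]//|t tQ Qt] := IHs (submod_of Q0 QD).
have tN x : x \in t -> x \in N by move=> /tQ/mem_submod_of[].
exists (v ++ t) => [x|x Nx].
  by rewrite mem_cat => /orP[/vN|/tN].
have [r sr] := Ns _ Nx.
have [|y vy sy] := uv r.
  by apply: Pu; apply/mem_submod_of; exists x.
have vtv z : in_span v z -> in_span (v ++ t) z.
  by apply: in_span_sub => b bv; apply: in_span_mem; rewrite mem_cat bv.
have Nxy : x - y \in N by apply: submodB => //; exact: in_span_min vy.
have sxy : in_span s (x - y).
  have -> : x - y = (-1) *: (y - r *: a) + (x - r *: a).
    by rewrite scaleN1r opprB [RHS]addrC addrA subrK.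
  exact: in_span_lin.
rewrite -(subrK y x) -[x - y]scale1r; apply: in_span_lin; last exact: vtv.
have : in_span t (x - y) by apply: Qt; apply/mem_submod_of.
by apply: in_span_sub => b bt; apply: in_span_mem; rewrite mem_cat bt orbT.
Qed.

(** The image of i is finitely generated as a submodule, and injectivity brings
    the relations back to M. *)
Lemma noetherian_fg_sub M M' (i : {linear M -> M'}) : noetherian R ->
  injective i -> finitely_generated M' -> finitely_generated M.
Proof.
move=> nR ii [s sM'].
pose P y := exists x, i x = y.
have P0 : P 0 by exists 0; rewrite linear0.
have PD a x y : P x -> P y -> P (a *: x + y).
  by move=> [u <-] [v <-]; exists (a *: u + v); rewrite linearP.
have [//|t tP Pt] := @noetherian_submod_fg M' s (submod_of P0 PD) nR.
have tP' y : y \in t -> exists x, i x = y by move=> /tP/mem_submod_of.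
have [u tu] : exists u, t = map i u.
  elim: t tP' {tP Pt} => [|y t IHt] ty; first by exists [::].
  have [|u ->] := IHt; first by move=> z zt; apply: ty; rewrite inE zt orbT.
  by have [x <-] := ty _ (mem_head y t); exists (x :: u).
exists u => x.
have : in_span t (i x) by apply: Pt; apply/mem_submod_of; exists x.
rewrite tu; elim: u x {tu} => /= [|y u IHu] x.
  by move=> ix0; apply: ii; rewrite ix0 linear0.
by case=> c; rewrite -linearZ -linearB => /IHu; exists c.
Qed.

End FiniteGeneration.

(** * Ideals of a Noetherian local ring *)

Section Ideals.
Variable R : comPzRingType.
Implicit Types (I J : ideal R) (M : lmodType R).

Section Operations.
Variables (M : lmodType R) (N : submodClosed M).

Section Colon.
Variable y : M.
Let P (c : R^o) := c *: y \in N.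
Let P0 : P 0. Proof. by rewrite /P scale0r rpred0. Qed.
Let PD a c d : P c -> P d -> P (a *: c + d).
Proof. by rewrite /P scalerDl -scalerA; exact: submod_lin. Qed.
Definition colon : ideal R := submod_of P0 PD.
Lemma mem_colon c : c \in colon <-> c *: y \in N.
Proof. exact: mem_submod_of. Qed.
End Colon.

Section Adjoin.
Variable y : M.
Let P z := exists c : R, z - c *: y \in N.
Let P0 : P 0. Proof. by exists 0; rewrite scale0r subr0 rpred0. Qed.
Let PD a u v : P u -> P v -> P (a *: u + v).
Proof.
move=> [c cN] [d dN]; exists (a * c + d).
have -> : a *: u + v - (a * c + d) *: y = a *: (u - c *: y) + (v - d *: y).
  by rewrite scalerBr scalerA scalerDl opprD addrACA.
exact: submod_lin.
Qed.
Definition adjoin : submodClosed M := submod_of P0 PD.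
Lemma mem_adjoin z : z \in adjoin <-> exists c : R, z - c *: y \in N.
Proof. exact: mem_submod_of. Qed.
End Adjoin.
End Operations.

(** Otherwise dependent choice gives a strictly increasing sequence in S; its
    union is an ideal whose finitely many generators all occur at one stage. *)
Lemma noetherian_max (S : ideal R -> Prop) I0 : noetherian R -> S I0 ->
  exists2 I, S I & forall J, S J -> {subset I <= J} -> {subset J <= I}.
Proof.
move=> nR SI0; apply: contrapT => nomax.
have step (I : {I | S I}) : exists J : {J | S J},
    {subset sval I <= sval J} /\ ~ {subset sval J <= sval I}.
  apply: contrapT => noJ; apply: nomax; exists (sval I); first exact: svalP I.
  move=> J SJ IJ; apply: contrapT => nJI.
  by apply: noJ; exists (exist _ J SJ).
have [f fP] := choice step.
pose u n := sval (iter n f (exist _ I0 SI0)).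
have uS n : {subset u n <= u n.+1} by have [] := fP (iter n f (exist _ I0 SI0)).
have ule m n : (m <= n)%N -> {subset u m <= u n}.
  by move/subnK<-; elim: (n - m)%N => // k IHk x /IHk; exact: uS.
pose P (x : R^o) := exists n, x \in u n.
have P0 : P 0 by exists 0%N; exact: rpred0.
have PD a x y : P x -> P y -> P (a *: x + y).
  move=> [k xk] [l yl]; exists (maxn k l).
  by apply: submod_lin; [apply: ule xk|apply: ule yl];
     rewrite ?leq_maxl ?leq_maxr.
have [s sP Ps] := noetherian_ideal_fg (submod_of P0 PD) nR.
have [n sn] : exists n, {subset s <= u n}.
  elim: s sP {Ps} => [|a s IHs] sP; first by exists 0%N.
  have /mem_submod_of[k ak] := sP _ (mem_head a s).
  have [|l sl] := IHs; first by move=> b bs; apply: sP; rewrite inE bs orbT.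
  exists (maxn k l) => b; rewrite inE => /predU1P[->|/sl].
    by apply: ule ak; exact: leq_maxl.
  by apply: ule; exact: leq_maxr.
have [_ []] := fP (iter n f (exist _ I0 SI0)).
move=> x xu; apply: in_span_min sn _; apply: Ps; apply/mem_submod_of.
by exists n.+1.
Qed.

Section Local.
Variable m : ideal R.
Hypothesis nR : noetherian R.
Hypothesis mmax : maximal_ideal m.
Hypothesis muniq : forall m' : ideal R, maximal_ideal m' -> m' =i m.

Lemma ideal_mul I (a x : R) : x \in I -> a * x \in I.
Proof. by move=> xI; exact: (@rpredZ _ R^o I a x). Qed.

Lemma sub_maximal I : 1 \notin I -> {subset I <= m}.
Proof.
move=> I1.
have [|J [IJ J1] Jmax] :=
    @noetherian_max (fun J => {subset I <= J} /\ 1 \notin J) I nR.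
  by split.
suff /muniq Jm : maximal_ideal J by move=> x /IJ; rewrite Jm.
split=> // K JK K1; apply: Jmax => //; split=> // x /IJ.
exact: JK.
Qed.

Lemma local_unit (x : R) : x \in m -> exists u, u * (1 - x) = 1.
Proof.
move=> xm; pose I : ideal R := span_submod [:: (1 - x : R^o)].
have [/mem_span_submod[u /= /eqP]|I1] := boolP ((1 : R^o) \in I).
  by rewrite subr_eq0 => /eqP e; exists u; exact: esym e.
have : (1 - x : R^o) \in m.
  by apply: (sub_maximal I1); apply/mem_span_submod/in_span_mem/mem_head.
move=> xm'; have [/negP[]] := mmax.
by rewrite -(subrK x 1); exact: (@rpredD R^o m).
Qed.

(** The first generator a satisfies (1 - x c) a = x w' modulo N with w' in the
    span of the others, and 1 - x c is a unit, so a can be eliminated from s.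
    Stating it relative to N avoids forming a quotient by coboundaries. *)
Lemma nakayama M (N : submodClosed M) (x : R) (s : seq M) : x \in m ->
    (forall z, z \in s -> exists2 w, in_span s w & z - x *: w \in N) ->
  {subset s <= N}.
Proof.
move=> xm; elim: s => // a s IHs sN.
have [w /= [c sw] aN] := sN _ (mem_head a s).
have [u uE] := local_unit (ideal_mul c xm).
set w' := w - c *: a in sw.
have aE : a - (u * x) *: w' \in N.
  have -> : a - (u * x) *: w' = u *: (a - x *: w).
    rewrite -{1}[a]scale1r -uE -!scalerA -scalerBr; congr (u *: _).
    by rewrite scalerBl scale1r scalerBr scalerA [x * c]mulrC opprB addrA subrK.
  exact: rpredZ.
clearbody w'.
have sN' : {subset s <= N}.
  apply: IHs => z zs; have [|v /= [d sv] zN] := sN z.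
    by rewrite inE zs orbT.
  exists (d *: ((u * x) *: w') + (v - d *: a)).
    apply: in_span_lin => //; rewrite -[_ *: w']addr0.
    exact/in_span_lin/in_span0.
  have -> : z - x *: (d *: ((u * x) *: w') + (v - d *: a))
      = (x * d) *: (a - (u * x) *: w') + (z - x *: v).
    rewrite !(scalerDr, scalerN, scalerA) !opprD !opprK !addrA mulrA.
    by rewrite [RHS](ACl (3*2*4*1)).
  exact: submod_lin.
move=> z; rewrite inE => /predU1P[->|/sN'//].
rewrite -(subrK ((u * x) *: w') a); apply: rpredD => //; apply: rpredZ.
exact: in_span_min sw.
Qed.

Section RegularElement.
Variable I : ideal R.

(** The annihilators of these classes in R/I are the maximal ones among
    annihilators of nonzero elements; they are primes, they are pairwise
    incomparable, and their union is the set of zero divisors on R/I. *)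
Definition max_annihilated (r : R^o) := r \notin I /\
  forall r', r' \notin I -> {subset colon I r <= colon I r'} ->
    {subset colon I r' <= colon I r}.

Lemma max_annihilated_above (r : R^o) : r \notin I ->
  exists2 r', max_annihilated r' & {subset colon I r <= colon I r'}.
Proof.
move=> rI; pose S J := exists r',
  [/\ r' \notin I, J = colon I r' & {subset colon I r <= colon I r'}].
have [|J [r' [r'I -> rr']] Jmax] := @noetherian_max S (colon I r) nR.
  by exists r; split.
exists r' => //; split=> // t tI rt; apply: (Jmax (colon I t)) => //.
by exists t; split=> // c /rr'/rt.
Qed.

Lemma max_annihilated_prime (r : R^o) (a b : R) : max_annihilated r ->
  (a * b) *: r \in I -> b *: r \notin I -> a *: r \in I.
Proof.
move=> [rI rmax] abI bI; apply/mem_colon; apply: (rmax _ bI).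
  move=> c /mem_colon cI; apply/mem_colon; rewrite scalerA mulrC -scalerA.
  exact: rpredZ.
by apply/mem_colon; rewrite scalerA.
Qed.

(** A list s of such classes whose span is maximal works: a further class r lies
    in the span of s, so its prime contains the intersection of the primes of s,
    hence one of them. *)
Lemma max_annihilated_finite : exists2 s : seq R^o,
    forall r, r \in s -> max_annihilated r &
    forall r, max_annihilated r ->
      exists2 r', r' \in s & {subset colon I r <= colon I r'}.
Proof.
pose S J := exists2 s : seq R^o,
  forall r, r \in s -> max_annihilated r & J = span_submod s.
have [|_ [s smax ->] Smax] := @noetherian_max S (span_submod [::]) nR.
  by exists [::].
exists s => // r rmax.
have sr : in_span s r.
  apply/mem_span_submod; apply: (Smax (span_submod (r :: s))).
  - by exists (r :: s) => // r'; rewrite inE => /predU1P[->|/smax].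
  - by move=> x /mem_span_submod sx; apply/mem_span_submod/in_span_cons.
  - by apply/mem_span_submod/in_span_mem/mem_head.
apply: contrapT => nos.
(* If no prime of s contains the prime of r, the product c of elements of the
   former outside the latter annihilates s modulo I but not r. *)
have [c cI cs] : exists2 c : R, c *: r \notin I &
    forall r', r' \in s -> c *: r' \in I.
  have {}nos r' : r' \in s -> exists2 d : R, d *: r' \in I & d *: r \notin I.
    move=> r's; apply: contrapT => nod; apply: nos; exists r' => //.
    have [r'I r'max] := smax _ r's; apply: r'max; first by case: rmax.
    move=> d /mem_colon dr'; apply/mem_colon.
    by have [//|dr] := boolP (d *: r \in I); case: nod; exists d.
  elim: s nos {smax Smax sr} => [|r' s IHs] nos.
    by exists 1 => //; rewrite scale1r; case: rmax.
  have [|c cr cs] := IHs; first by move=> t ts; apply: nos; rewrite inE ts orbT.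
  have [d dr' dr] := nos _ (mem_head r' s).
  exists (c * d).
    by apply: contra cr => cdr; exact: max_annihilated_prime rmax cdr dr.
  move=> t; rewrite inE => /predU1P[->|/cs ct].
    by rewrite -scalerA; exact: rpredZ.
  by rewrite mulrC -scalerA; exact: rpredZ.
case/negP: cI; elim: s r sr cs {smax Smax nos rmax} => /= [|t s IHs] r.
  by move=> -> _; rewrite scaler0; exact: rpred0.
case=> d sr cs; rewrite -(subrK (d *: t) r) scalerDr.
apply: rpredD.
  by apply: IHs sr _ => t' t's; apply: cs; rewrite inE t's orbT.
by rewrite scalerA mulrC -scalerA; apply/rpredZ/cs/mem_head.
Qed.

(** Prime avoidance: if no nonzero class of R/I is killed by m, then m is not
    contained in any maximal annihilator, hence not in the union of the finitely
    many that occur. *)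
Lemma exists_regular_element :
    (forall r : R^o, (forall c : R, c \in m -> c *: r \in I) -> r \in I) ->
  exists2 x : R, x \in m & forall r : R^o, x *: r \in I -> r \in I.
Proof.
move=> nosocle; have [s smax sall] := max_annihilated_finite.
have out (r : R^o) : max_annihilated r ->
    exists2 c : R, c \in m & c *: r \notin I.
  move=> [rI _]; apply: contrapT => noc; case/negP: rI.
  apply: nosocle => c cm; have [//|cr] := boolP (c *: r \in I).
  by case: noc; exists c.
have [x xm xs] : exists2 x : R, x \in m & forall r, r \in s -> x *: r \notin I.
  elim: s smax {sall} => [|r s IHs] smax; first by exists 0; [exact: rpred0|].
  have smax' t : t \in s -> max_annihilated t.
    by move=> ts; apply: smax; rewrite inE ts orbT.
  have rmax := smax _ (mem_head r s).
  have [x xm xs] := IHs smax'.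
  have [xr|xr] := boolP (x *: r \in I); last first.
    by exists x => // t; rewrite inE => /predU1P[->|/xs].
  (* As x lies in the prime of r, it is enough to correct it by a y in m that
     lies in the primes of s but not in that of r. *)
  have [y [ym yr ys]] : exists y : R,
      [/\ y \in m, y *: r \notin I & forall t, t \in s -> y *: t \in I].
    have dodge t : t \in s -> exists2 d : R, d *: t \in I & d *: r \notin I.
      move=> ts; apply: contrapT => nod; case/negP: (xs _ ts).
      have [tI tmax] := smax' _ ts; apply/mem_colon.
      apply: (tmax r); last by apply/mem_colon.
        by case: rmax.
      move=> d /mem_colon dt; apply/mem_colon.
      by have [//|dr] := boolP (d *: r \in I); case: nod; exists d.
    elim: s dodge {smax smax' IHs xs} => [|t s IHs] dodge.
      by have [c cm cr] := out r rmax; exists c.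
    have [|y [ym yr ys]] := IHs.
      by move=> t' t's; apply: dodge; rewrite inE t's orbT.
    have [d dt dr] := dodge _ (mem_head t s).
    exists (d * y); split; first exact: ideal_mul.
      by apply: contra dr => dyr; exact: max_annihilated_prime rmax dyr yr.
    move=> t'; rewrite inE => /predU1P[->|/ys t'I].
      by rewrite mulrC -scalerA; exact: rpredZ.
    by rewrite -scalerA; exact: rpredZ.
  exists (x + y); first exact: (@rpredD R^o m).
  move=> t; rewrite inE scalerDl => /predU1P[->|ts].
    by apply: contra yr => /submodB/(_ xr); rewrite addrC addKr.
  by apply: contra (xs _ ts) => /submodB/(_ (ys _ ts)); rewrite addrK.
exists x => // r xr; have [//|rI] := boolP (r \in I).
have [r' r'max rr'] := max_annihilated_above rI.
have [t ts r't] := sall _ r'max.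
by case/negP: (xs _ ts); apply/mem_colon/r't/rr'/mem_colon.
Qed.

End RegularElement.
End Local.
End Ideals.

(** * Finite projective covers and separating families of functionals *)

Section Covers.
Variable R : comPzRingType.
Implicit Types M P : lmodType R.

Lemma in_span_preimage M M' (f : {linear M -> M'}) (s : seq M) y :
  in_span (map f s) y -> exists2 x, in_span s x & f x = y.
Proof.
elim: s y => /= [|a s IHs] y; first by move=> ->; exists 0; rewrite ?linear0.
case=> c /IHs[x sx fx]; exists (x + c *: a); last first.
  by rewrite linearD linearZ fx subrK.
by exists c; rewrite addrK.
Qed.

Lemma in_span_catl M (s t : seq M) x : in_span s x -> in_span (s ++ t) x.
Proof.
by apply: in_span_sub => a sa; apply: in_span_mem; rewrite mem_cat sa.
Qed.

Lemma in_span_catr M (s t : seq M) x : in_span t x -> in_span (s ++ t) x.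
Proof.
by apply: in_span_sub => a ta; apply: in_span_mem; rewrite mem_cat ta orbT.
Qed.

Lemma fg_extension M M' (f : {linear M -> M'}) (v : seq M) :
    finitely_generated (submodule (kernel f)) ->
    (forall x, in_span (map f v) (f x)) ->
  finitely_generated M.
Proof.
move=> [w wf] vf; exists (map sub_incl w ++ v) => x.
have [y vy fyx] := in_span_preimage (vf x).
have [|z zE] := @sub_incl_surj _ _ (kernel f) (x - y).
  by apply/mem_kernel; rewrite linearB fyx subrr.
rewrite -(subrK y x) -[x - y]scale1r -zE; apply: in_span_lin.
  exact/in_span_catl/in_span_linear.
exact: in_span_catr.
Qed.

Lemma linear_inl M M' :
  exists i : {linear M -> (M * M')%type}, forall x, i x = (x, 0).
Proof.
by apply: linear_ex => a x y; congr pair; rewrite /= scaler0 addr0.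
Qed.

Lemma linear_inr M M' :
  exists j : {linear M' -> (M * M')%type}, forall x, j x = (0, x).
Proof.
by apply: linear_ex => a x y; congr pair; rewrite /= scaler0 addr0.
Qed.

Lemma fg_prod M M' :
  finitely_generated M -> finitely_generated M' ->
  finitely_generated ((M * M')%type : lmodType R).
Proof.
move=> [s sM] [t tM]; exists (map (fun a => (a, 0)) s ++ map (pair 0) t).
have [i iE] := linear_inl M M'; have [j jE] := linear_inr M M'.
case=> x y; have -> : (x, y) = 1 *: i x + j y.
  by rewrite scale1r iE jE; congr pair; rewrite /= ?addr0 ?add0r.
apply: in_span_lin.
  by apply: in_span_catl; rewrite -(eq_map iE); exact: in_span_linear.
by apply: in_span_catr; rewrite -(eq_map jE); exact: in_span_linear.
Qed.

Lemma linear_from_regular M (a : M) :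
  exists f : {linear R^o -> M}, forall c, f c = c *: a.
Proof.
by apply: linear_ex => b c d; rewrite scalerDl scalerA.
Qed.

Lemma linear_from_prod M M' P (f : {linear M -> P}) (g : {linear M' -> P}) :
  exists h : {linear (M * M')%type -> P}, forall x, h x = f x.1 + g x.2.
Proof.
by apply: linear_ex => a x y; rewrite !linearP scalerDr addrACA.
Qed.

Lemma projective_regular : projective (R^o : lmodType R).
Proof.
move=> A B f g fs; have [a fa] := fs (g 1).
have [h hE] := linear_from_regular a; exists h => c.
by rewrite hE linearZ fa -linearZ; congr (g _); exact: mulr1.
Qed.

Lemma projective_prod P P' : projective P -> projective P' ->
  projective ((P * P')%type : lmodType R).
Proof.
move=> Pp Pp' A B f g fs.
have [i iE] := linear_inl P P'; have [j jE] := linear_inr P P'.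
have [h hE] := Pp _ _ f (g \o i) fs.
have [h' h'E] := Pp' _ _ f (g \o j) fs.
have [k kE] := linear_from_prod h h'; exists k => -[x y].
rewrite kE linearD hE h'E /= -linearD iE jE; congr (g (_, _)); rewrite /=.
  by rewrite addr0.
by rewrite add0r.
Qed.

Lemma projective_cover M : finitely_generated M ->
  exists (F : lmodType R) (f : {linear F -> M}),
    [/\ projective F, finitely_generated F & surjective f].
Proof.
move=> [s sM]; suff [F [f [Fp Ffg fs]]] : exists (F : lmodType R)
    (f : {linear F -> M}), [/\ projective F, finitely_generated F &
      forall x, in_span s x -> exists y, f y = x].
  by exists F, f; split=> // x; exact: fs.
elim: s {sM} => [|a s [F [f [Fp Ffg fs]]]].
  exists (R^o : lmodType R), \0; split=> [||x ->]; last by exists 0.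
  - exact: projective_regular.
  - exact: fg_regular.
have [g gE] := linear_from_regular a; have [h hE] := linear_from_prod g f.
exists ((R^o * F)%type : lmodType R), h; split.
- exact: projective_prod projective_regular Fp.
- exact: fg_prod (fg_regular R) Ffg.
- move=> x [c /fs[y fy]]; exists (c, y).
  by rewrite hE /= gE fy addrC subrK.
Qed.

(** A module on which finitely many functionals vanish together only at 0 embeds
    in a finite free module. The induction splits off one functional: its image
    is an ideal, and the remaining functionals separate its kernel. *)
Lemma fg_separated (I : eqType) M (ev : I -> {linear M -> R^o}) (s : seq I) :
    noetherian R ->
    (forall x, (forall i, i \in s -> ev i x = 0) -> x = 0) ->
  finitely_generated M.
Proof.
move=> nR; elim: s M ev => [|i s IHs] M ev sep.
  by exists [::] => x; exact: sep.
pose P (r : R^o) := exists x, ev i x = r.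
have P0 : P 0 by exists 0; rewrite linear0.
have PD a r r' : P r -> P r' -> P (a *: r + r').
  by move=> [x <-] [y <-]; exists (a *: x + y); rewrite linearP.
have [t tP Pt] := noetherian_ideal_fg (submod_of P0 PD) nR.
have [v tE] : exists v, t = map (ev i) v.
  elim: t tP {Pt} => [|r t IHt] tP; first by exists [::].
  have /mem_submod_of[x xr] := tP _ (mem_head r t).
  have [|v ->] := IHt; first by move=> r' r't; apply: tP; rewrite inE r't orbT.
  by exists (x :: v); rewrite /= xr.
apply: (@fg_extension _ _ (ev i) v).
  apply: (IHs _ (fun j => ev j \o sub_incl)) => x sx.
  apply: sub_incl_inj; rewrite linear0; apply: sep => j.
  rewrite inE => /predU1P[->|/sx//].
  by apply/mem_kernel; exact: sub_incl_mem.
by move=> x; rewrite -tE; apply: Pt; apply/mem_submod_of; exists x.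
Qed.

End Covers.

(** * Ext with values in the ring *)

Section Ext.
Variables (R : comPzRingType) (E : nat -> lmodType R).
Variables (d : forall i, {linear E i -> E i.+1}).
Variables (coaug : {linear R^o -> E 0%N}).
Hypotheses (Einj : forall i, injective_module (E i)).
Hypotheses (coaug_inj : injective coaug) (exact0 : exact coaug (d 0%N)).
Hypothesis (exactS : forall i, exact (d i) (d i.+1)).
Implicit Types A B C M P : lmodType R.

Lemma d_d i x : d i.+1 (d i x) = 0.
Proof. by apply/exactS; exists x. Qed.

(** Ext^i(M, R) is the cohomology at i of Hom(M, E). Only its vanishing and its
    finite generation are needed, so cocycles and coboundaries suffice and the
    groups themselves are not formed. *)
Definition cocycle i M (g : {linear M -> E i}) := forall x, d i (g x) = 0.

(** Vanishing of Ext^(i+1)(M, R): the index is that of the cochains that have to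
    be corrected, which keeps i = 0 free for the first derived functor. *)
Definition ext_vanishes i M := forall g : {linear M -> E i.+1},
  cocycle g -> exists h : {linear M -> E i}, forall x, d i (h x) = g x.

Lemma ext_vanishes_retract i A B (f : {linear A -> B}) (g : {linear B -> A}) :
  (forall x, g (f x) = x) -> ext_vanishes i B -> ext_vanishes i A.
Proof.
move=> fK vB a az; have [x|h hE] := vB (a \o g).
  exact: az.
by exists (h \o f) => x; rewrite /= hE /= fK.
Qed.

Lemma ext_vanishes_projective i P : projective P -> ext_vanishes i P.
Proof. by move=> Pp g gz; exact: projective_lift Pp (@exactS i) gz. Qed.

Section LongExactSequence.
Variables (A B C : lmodType R) (f : {linear A -> B}) (g : {linear B -> C}).
Hypothesis fg : short_exact f g.

Lemma factor_cokernel M (b : {linear B -> M}) : (forall x, b (f x) = 0) ->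
  exists c : {linear C -> M}, forall x, c (g x) = b x.
Proof.
case: fg => _ fgx gs bf; apply: factor_surj => // x /fgx[y <-].
exact: bf.
Qed.

Lemma short_exact_comp0 x : g (f x) = 0.
Proof. by case: fg => _ fgx _; apply/fgx; exists x. Qed.

(** An extension of a to B exists because E i is injective; its differential is
    a cocycle on C, hence a coboundary, which is subtracted. In the long exact
    sequence this is the surjectivity of Ext^i(B, R) -> Ext^i(A, R). *)
Lemma cocycle_extend i (a : {linear A -> E i}) :
  ext_vanishes i C -> cocycle a ->
  exists2 b : {linear B -> E i}, cocycle b & forall x, b (f x) = a x.
Proof.
case: (fg) => fi _ gs vC az; have [b bE] := Einj a fi.
have [x|c cE] := @factor_cokernel _ (d i \o b); first by rewrite /= bE az.
have [x|h hE] := vC c.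
  by have [y <-] := gs x; rewrite cE; exact: d_d.
have [b' b'E] : exists b' : {linear B -> E i}, forall x, b' x = b x - h (g x).
  by exists (b \- (h \o g)).
exists b' => x; first by rewrite b'E linearB hE cE subrr.
by rewrite b'E bE short_exact_comp0 linear0 subr0.
Qed.

Lemma ext_vanishes_left i :
  ext_vanishes i.+1 C -> ext_vanishes i B -> ext_vanishes i A.
Proof.
move=> vC vB a /(cocycle_extend vC)[b bz bE]; have [h hE] := vB b bz.
by exists (h \o f) => x; rewrite /= hE bE.
Qed.

(** Correct a cocycle on B by the differential of an extension of its primitive
    on A; what is left is a cocycle on C. *)
Lemma ext_vanishes_middle i :
  ext_vanishes i A -> ext_vanishes i C -> ext_vanishes i B.
Proof.
case: (fg) => fi _ gs vA vC b bz; have [x|a aE] := vA (b \o f).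
  exact: bz.
have [a' a'E] := Einj a fi.
have [x|c cE] := @factor_cokernel _ (b \- (d i \o a')).
  by rewrite /= a'E aE subrr.
have [x|h hE] := vC c.
  by have [y <-] := gs x; rewrite cE /= linearB bz d_d subr0.
have [k kE] : exists k : {linear B -> E i}, forall x, k x = a' x + h (g x).
  by exists (a' \+ (h \o g)).
by exists k => x; rewrite kE linearD hE cE /= addrC subrK.
Qed.

(** A primitive on B of a cocycle of C restricts to a cocycle on A; subtracting
    the differential of an extension of its primitive makes it descend to C. *)
Lemma ext_vanishes_right i :
  ext_vanishes i A -> ext_vanishes i.+1 B -> ext_vanishes i.+1 C.
Proof.
case: (fg) => fi _ gs vA vB c cz; have [x|b bE] := vB (c \o g).
  exact: cz.
have [x|a aE] := vA (b \o f).
  by rewrite /= bE /= short_exact_comp0 linear0.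
have [a' a'E] := Einj a fi.
have [x|k kE] := @factor_cokernel _ (b \- (d i \o a')).
  by rewrite /= a'E aE subrr.
exists k => x; have [y <-] := gs x.
by rewrite kE linearB /= d_d subr0 bE.
Qed.

End LongExactSequence.

(** The case i = 0 of the extension of cocycles: cocycles with values in E 0 are
    the maps to R. *)
Lemma linear_extend A B C (f : {linear A -> B}) (g : {linear B -> C})
    (u : {linear A -> R^o}) :
  short_exact f g -> ext_vanishes 0 C ->
  exists v : {linear B -> R^o}, forall x, v (f x) = u x.
Proof.
move=> fg vC; have [|b bz bE] := cocycle_extend (a := coaug \o u) fg vC.
  by move=> x; apply/exact0; exists (u x).
have [v vE] : exists v : {linear B -> R^o}, forall x, coaug (v x) = b x.
  by apply: factor_inj => // x; apply/exact0/bz.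
by exists v => x; apply: coaug_inj; rewrite vE bE.
Qed.

Section Finiteness.
Hypothesis nR : noetherian R.

(** In degree 0 there are no coboundaries but 0, so that the degree 0 cohomology
    is Hom(M, R); this makes dimension shifting uniform. Plain functions are
    used because they form a module. *)
Definition coboundary M i : (M -> E i) -> Prop :=
  match i with
  | 0 => fun g => forall x, g x = 0
  | j.+1 => fun g => exists h : {linear M -> E j}, forall x, d j (h x) = g x
  end.

Lemma coboundary0 M i : @coboundary M i 0.
Proof. by case: i => //= i; exists \0 => x; rewrite linear0. Qed.

Lemma coboundary_lin M i a (g g' : M -> E i) :
  coboundary g -> coboundary g' -> coboundary (a *: g + g').
Proof.
case: i g g' => [|i] g g' /=.
  move=> g0 g0' x; rewrite -[LHS]/(a *: g x + g' x).
  by rewrite g0 g0' scaler0 addr0.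
move=> [h hE] [h' h'E]; have [k kE] : exists k : {linear M -> E i},
    forall x, k x = a *: h x + h' x.
  by exists ((a \*: h) \+ h').
by exists k => x; rewrite kE linearP hE h'E.
Qed.

Definition coboundaries M i : submodClosed (M -> E i) :=
  submod_of (@coboundary0 M i) (@coboundary_lin M i).

Definition cohomology_fg i M := exists2 s : seq (M -> E i),
  forall z, z \in s -> exists2 g : {linear M -> E i}, cocycle g & z = g &
  forall g : {linear M -> E i}, cocycle g ->
    exists2 w, in_span s w & coboundary (fun x => g x - w x).

(** Evaluation at generators of M embeds Hom(M, R) in a finite free module. *)
Lemma cohomology_fg0 M : finitely_generated M -> cohomology_fg 0 M.
Proof.
move=> [s sM].
pose L (f : M -> R^o) := linear f.
have L0 : L 0 by move=> a x y; rewrite scaler0 addr0.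
have LD a (f g : M -> R^o) : L f -> L g -> L (a *: f + g).
  move=> lf lg b x y; rewrite !fctE /= lf lg.
  by rewrite scalerDr !scalerA mulrC -!scalerA addrACA -scalerDr.
pose H := submodule (submod_of L0 LD).
have [ev evE] : exists ev : M -> {linear H -> R^o},
    forall x f, ev x f = sub_incl f x.
  suff /choice[ev evE] x : exists e : {linear H -> R^o},
      forall f, e f = sub_incl f x.
    by exists ev.
  by apply: linear_ex => a f g; rewrite linearP.
have [|t tH] := @fg_separated _ _ _ ev s nR.
  move=> f fs; apply: sub_incl_inj; rewrite linear0; apply/funext => x.
  have /mem_submod_of Lf := sub_incl_mem f.
  have [f' f'E] := linear_ex Lf; rewrite -f'E.
  apply/mem_kernel; apply: in_span_min (sM x) => y /fs.
  by rewrite evE => fy0; apply/mem_kernel; rewrite f'E.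
exists (map (fun f x => coaug (sub_incl f x)) t).
  move=> _ /mapP[f _ ->]; have /mem_submod_of Lf := sub_incl_mem f.
  have [f' f'E] := linear_ex Lf; exists (coaug \o f').
    by move=> x; apply/exact0; exists (f' x).
  by apply/funext => x; rewrite /= f'E.
move=> g gz.
have [u uE] : exists u : {linear M -> R^o}, forall x, coaug (u x) = g x.
  by apply: factor_inj => // x; apply/exact0/gz.
have [|f fE] := @sub_incl_surj _ _ (submod_of L0 LD) u.
  by apply/mem_submod_of => a x y; rewrite linearP.
have [c cE] : exists c : {linear H -> (M -> E 0%N)},
    forall f, c f = fun x => coaug (sub_incl f x).
  by apply: linear_ex => a f1 f2; apply/funext => x; rewrite !linearP.
exists (c f).
  by rewrite -(eq_map cE); exact/in_span_linear.
by move=> x; rewrite cE fE uE subrr.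
Qed.

Lemma coboundary_extend i A B (f : {linear A -> B}) (w : A -> E i) :
  injective f -> coboundary w ->
  exists2 b : {linear B -> E i}, forall x, b (f x) = w x & cocycle b.
Proof.
move=> fi; case: i w => [|i] w /=.
  by move=> w0; exists \0 => x; rewrite ?linear0 ?w0.
move=> [c cE]; have [c' c'E] := Einj c fi.
by exists (d i \o c') => x; rewrite /= ?d_d // c'E cE.
Qed.

(** Dimension shifting: the connecting map from the cohomology of A to that of C
    is onto because the next cohomology of B vanishes. The list t is the image
    of the generators s under it. *)
Lemma cohomology_fgS i A B C (f : {linear A -> B}) (g : {linear B -> C}) :
  short_exact f g -> ext_vanishes i B -> cohomology_fg i A ->
  cohomology_fg i.+1 C.
Proof.
move=> fg; case: (fg) => fi fgx gs vB [s sz sall].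
have [t tz ts] : exists2 t : seq (C -> E i.+1),
    forall z, z \in t -> exists2 h : {linear C -> E i.+1}, cocycle h & z = h &
    forall w, in_span s w -> exists2 w', in_span t w' &
      exists2 v : {linear B -> E i}, forall x, v (f x) = w x &
        forall x, d i (v x) = w' (g x).
  elim: s sz {sall} => [|u s IHs] sz.
    exists [::] => // w /= ->; exists 0 => //; exists \0 => //= x.
    by rewrite linear0.
  have [u' u'z uE] := sz _ (mem_head u s).
  have [|t tz ts] := IHs; first by move=> z zs; apply: sz; rewrite inE zs orbT.
  have [v vE] := Einj u' fi.
  have [x|z zE] := factor_cokernel fg (b := d i \o v); first by rewrite /= vE.
  exists ((z : C -> _) :: t) => [h|w [c /ts[w' tw' [v' v'E v'w']]]].
    rewrite inE => /predU1P[->|/tz//]; exists z => // x.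
    by have [y <-] := gs x; rewrite zE; exact: d_d.
  exists (c *: (z : C -> _) + w').
    by exists c; rewrite addrAC subrr add0r.
  have [k kE] : exists k : {linear B -> E i}, forall x, k x = c *: v x + v' x.
    by exists ((c \*: v) \+ v').
  exists k => x; rewrite kE.
    by rewrite vE v'E uE addrC subrK.
  by rewrite linearP v'w' !fctE; congr (_ + _); rewrite /GRing.scale /= zE.
exists t => // a az.
have [x|h hE] := vB (a \o g); first exact: az.
have [x|w /ts[w' tw' [v vE vw']]] := sall (h \o f).
  by rewrite /= hE /= (short_exact_comp0 fg) linear0.
move=> bw; have [b bE db] : exists2 b : {linear B -> E i},
    forall x, b (f x) = h (f x) - w x & forall x, d i (b x) = 0.
  exact: coboundary_extend fi bw.
exists w' => //=.
have [x|k kE] := factor_cokernel fg (b := (h \- v) \- b).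
  by rewrite /= bE vE subrr.
exists k => x; have [y <-] := gs x.
by rewrite kE /= !linearB db hE vw' subr0.
Qed.

Lemma cohomology_finite i M : finitely_generated M -> cohomology_fg i M.
Proof.
elim: i M => [|i IHi] M Mfg; first exact: cohomology_fg0.
have [F [f [Fp Ffg fs]]] := projective_cover Mfg.
have se := short_exact_kernel fs.
apply: (cohomology_fgS se (ext_vanishes_projective Fp)).
apply: IHi; apply: (noetherian_fg_sub nR _ Ffg).
exact: sub_incl_inj.
Qed.

Section Local.
Variable m : ideal R.
Hypothesis mmax : maximal_ideal m.
Hypothesis muniq : forall m' : ideal R, maximal_ideal m' -> m' =i m.

(** Every cocycle on M extends along multiplication by x, so it is x times a
    cocycle, and Nakayama applies to the finitely generated cohomology. *)
Lemma ext_vanishes_regular i M C (x : R) (f : {linear M -> M})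
    (g : {linear M -> C}) :
  x \in m -> (forall y, f y = x *: y) -> finitely_generated M ->
  short_exact f g -> ext_vanishes i.+1 C -> ext_vanishes i M.
Proof.
move=> xm fx Mfg fg vC.
have [s sz sall] := cohomology_finite i.+1 Mfg.
have sN : {subset s <= coboundaries M i.+1}.
  apply: (nakayama nR mmax muniq xm) => _ /sz[a az ->].
  have [b bz bE] := cocycle_extend fg vC az.
  have [w sw bw] := sall b bz; exists w => //.
  apply/mem_submod_of.
  have -> : (a : M -> _) - x *: w = x *: (fun y => b y - w y) + 0.
    apply/funext => y; rewrite !fctE addr0 scalerBr -bE fx linearZ.
    by congr (_ + _).
  by apply: coboundary_lin; last exact: coboundary0.
move=> a /sall[w sw [h hE]].
have /mem_submod_of[k kE] := in_span_min sN sw.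
have [l lE] : exists l : {linear M -> E i}, forall x, l x = h x + k x.
  by exists (h \+ k).
by exists l => y; rewrite lE linearD hE kE subrK.
Qed.

End Local.
End Finiteness.
End Ext.

(** * Exact sequences of quotients *)

Section QuotientSequences.
Variable R : comPzRingType.
Implicit Types A B M : lmodType R.

Lemma fg_quot M (N : submodClosed M) :
  finitely_generated M -> finitely_generated (quot_module N).
Proof. exact: (fg_surj (f := quot_proj N) (@quot_proj_surj _ _ N)). Qed.

Lemma quot_lift M B (N : submodClosed M) (f : {linear M -> B}) :
    (forall x, x \in N -> f x = 0) ->
  exists g : {linear quot_module N -> B}, forall x, g (quot_proj N x) = f x.
Proof.
move=> fN; apply: factor_surj; first exact: quot_proj_surj.
by move=> x /quot_proj_eq0/fN.
Qed.

Lemma cokernel_exact A B (f : {linear A -> B}) : injective f ->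
  exists (N : submodClosed B), short_exact f (quot_proj N).
Proof.
move=> fi; pose P y := exists x, f x = y.
have P0 : P 0 by exists 0; rewrite linear0.
have PD a x y : P x -> P y -> P (a *: x + y).
  by move=> [u <-] [v <-]; exists (a *: u + v); rewrite linearP.
exists (submod_of P0 PD); split=> //; last exact: quot_proj_surj.
by move=> y; rewrite quot_proj_eq0 mem_submod_of.
Qed.

(** The sequence 0 -> M/(N : x) -> M/N -> M/(N + xM) -> 0. The submodules N' and
    N'' are characterised and not constructed, so that N' may be N itself when x
    is regular on M/N, and both may be Frobenius pushforwards of ideals. *)
Lemma quot_scale_exact M (N N' N'' : submodClosed M) (x : R) :
    (forall y, y \in N' <-> x *: y \in N) ->
    (forall z, z \in N'' <-> exists y, z - x *: y \in N) ->
  exists (f : {linear quot_module N' -> quot_module N})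
         (g : {linear quot_module N -> quot_module N''}),
    short_exact f g /\ forall y, f (quot_proj N' y) = quot_proj N (x *: y).
Proof.
move=> N'E N''E.
have [s sE] : exists s : {linear M -> quot_module N},
    forall y, s y = quot_proj N (x *: y).
  apply: linear_ex => a y z.
  by rewrite scalerDr scalerA mulrC -scalerA linearP.
have [y /N'E yN|f fE] := @quot_lift _ _ N' s.
  by rewrite sE; apply/quot_proj_eq0.
have [y yN|g gE] := @quot_lift _ _ N (quot_proj N'').
  by apply/quot_proj_eq0/N''E; exists 0; rewrite scaler0 subr0.
exists f, g; split=> [|y]; last by rewrite fE sE.
split.
- apply: linear_inj => y'; have [y <-] := quot_proj_surj y'.
  by rewrite fE sE => /quot_proj_eq0/N'E/quot_proj_eq0.
- move=> z'; have [z <-] := quot_proj_surj z'; rewrite gE.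
  split=> [/quot_proj_eq0/N''E[y yz]|[y' ]].
    exists (quot_proj N' y); rewrite fE sE; apply/esym/eqP.
    by rewrite -subr_eq0 -linearB; apply/eqP/quot_proj_eq0.
  have [y <-] := quot_proj_surj y'; rewrite fE sE => yz.
  apply/quot_proj_eq0/N''E; exists y; apply/quot_proj_eq0.
  by rewrite linearB yz subrr.
- move=> z; have [z' <-] := quot_proj_surj z.
  by exists (quot_proj N z'); rewrite gE.
Qed.

End QuotientSequences.

(** * Vanishing of Ext on the Frobenius pushforward *)

Section Vanishing.
Variables (R : comPzRingType) (E : nat -> lmodType R).
Variables (d : forall i, {linear E i -> E i.+1}).
Variables (coaug : {linear R^o -> E 0%N}).
Hypotheses (Einj : forall i, injective_module (E i)).
Hypotheses (coaug_inj : injective coaug) (exact0 : exact coaug (d 0%N)).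
Hypothesis (exactS : forall i, exact (d i) (d i.+1)).
Hypothesis nR : noetherian R.
Variable m : ideal R.
Hypothesis mmax : maximal_ideal m.
Hypothesis muniq : forall m' : ideal R, maximal_ideal m' -> m' =i m.
Local Notation ext_vanishes := (ext_vanishes d).
Implicit Types M : lmodType R.

(** The submodule generated by the first generator is cyclic, and the quotient
    by it has fewer generators. *)
Lemma ext_vanishes_fg i :
  (forall I : ideal R, ext_vanishes i (quot_module I)) ->
  forall M, finitely_generated M -> ext_vanishes i M.
Proof.
move=> vcyc M [s]; have [n] := ubnP (size s).
elim: n M s => // n IHn M [|a s] sn sM.
  by move=> g _; exists \0 => x; rewrite (sM x) !linear0.
have [f fE] := linear_from_regular a.
have [y|f' f'E] := @quot_lift _ _ _ (kernel f) f; first by move/mem_kernel.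
have f'i : injective f'.
  apply: linear_inj => y'; have [y <-] := quot_proj_surj y'.
  by rewrite f'E => /mem_kernel/quot_proj_eq0.
have [N fg] := cokernel_exact f'i.
apply: (ext_vanishes_middle Einj exactS fg); first exact: vcyc.
apply: (IHn _ (map (quot_proj N) s)) => [|y]; first by rewrite size_map.
have [x <-] := quot_proj_surj y; have [c sx] := sM x.
have <- : quot_proj N (x - c *: a) = quot_proj N x.
  rewrite linearB -fE -f'E.
  move: (short_exact_comp0 fg (quot_proj (kernel f) c)) => ->.
  by rewrite subr0.
exact: in_span_linear.
Qed.

(** By the shift of indices, this says that Ext^i(M, R) = 0 for all i > n. *)
Definition ext_vanishes_from n :=
  forall M, finitely_generated M -> forall i, (n <= i)%N -> ext_vanishes i M.

Lemma fg_cyclic (I : ideal R) : finitely_generated (quot_module I).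
Proof. exact/fg_quot/fg_regular. Qed.

(** Take J maximal among the ideals at which vanishing fails; J is properly
    contained in m. For x in m outside J the two outer terms of
    0 -> R/(J : x) -> R/J -> R/(J + xR) -> 0 are covered by maximality, unless
    J : x = J; in that case x is regular on R/J and Nakayama gives vanishing at
    R/J. So vanishing holds on all cyclic modules, which is enough. *)
Lemma ext_vanishes_residue n : ext_vanishes_from n.+1 ->
  ext_vanishes n (quot_module m) -> ext_vanishes_from n.
Proof.
move=> vn1 vm M Mfg i; rewrite leq_eqVlt => /predU1P[<-|]; last exact: vn1.
apply: ext_vanishes_fg M Mfg => I; apply: contrapT => nvI.
pose S (J : ideal R) := ~ ext_vanishes n (quot_module J).
have [{nvI}J nvJ Jmax] := @noetherian_max _ S I nR nvI.
have vJ (K : ideal R) (x : R) : {subset J <= K} -> x \in K -> x \notin J ->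
    ext_vanishes n (quot_module K).
  by move=> JK xK /negP xJ; apply: contrapT => /Jmax/(_ JK)/(_ _ xK).
have [J1|J1] := boolP (1 \in J).
  apply: nvJ => g _; exists \0 => y; have [x <-] := quot_proj_surj y.
  have /quot_proj_eq0 -> : x \in J by rewrite -[x]mulr1; exact: ideal_mul.
  by rewrite !linear0.
have Jm := sub_maximal nR muniq J1.
have [mJ|] := pselect {subset m <= J}.
  have [x /Jm/quot_proj_eq0//|f fE] := @quot_lift _ _ _ J (quot_proj m).
  have [x /mJ/quot_proj_eq0//|g gE] := @quot_lift _ _ _ m (quot_proj J).
  apply/nvJ/(ext_vanishes_retract (f := f) (g := g)) => // y.
  by have [x <-] := quot_proj_surj y; rewrite fE gE.
move=> /existsNP[x /not_implyP[xm /negP xJ]].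
have adjE z : z \in adjoin J (x : R^o) <-> exists y : R^o, z - x *: y \in J.
  by rewrite mem_adjoin; split=> -[c cJ]; exists c;
     rewrite [_ *: _](mulrC _ _).
have [colJ|] := pselect {subset colon J x <= J}.
  have colE y : y \in J <-> x *: y \in J.
    split=> [yJ|xyJ]; first exact: rpredZ.
    by apply/colJ/mem_colon; rewrite [_ *: _]mulrC.
  have [f [g [fg fE]]] := quot_scale_exact colE adjE.
  apply: nvJ; apply: (ext_vanishes_regular Einj coaug_inj exact0 exactS nR
    mmax muniq xm _ _ fg).
  - by move=> y'; have [y <-] := quot_proj_surj y'; rewrite fE linearZ.
  - exact: fg_cyclic.
  - by apply: vn1 => //; exact: fg_cyclic.
move=> /existsNP[y /not_implyP[yc /negP yJ]].
have colE z : z \in colon J x <-> x *: z \in J.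
  by rewrite mem_colon [_ *: _]mulrC.
have [f [g [fg _]]] := quot_scale_exact colE adjE.
apply: nvJ; apply: (ext_vanishes_middle Einj exactS fg).
  apply: vJ yc yJ => z zJ; apply/colE; exact: rpredZ.
apply: (vJ _ x) xJ => [z zJ|]; apply/mem_adjoin.
  by exists 0; rewrite scale0r subr0.
by exists 1; rewrite scale1r subrr rpred0.
Qed.

(** The class of r spans a copy of the residue field in R/I, and Ext^(n+1) is
    right exact when Ext^(n+2) vanishes. *)
Lemma ext_vanishes_socle n (I : ideal R) (r : R^o) : ext_vanishes_from n.+1 ->
    ext_vanishes n (quot_module I) -> r \notin I ->
    (forall c : R, c \in m -> c *: r \in I) ->
  ext_vanishes n (quot_module m).
Proof.
move=> vn1 vI rI mr; have [f fE] := linear_from_regular (quot_proj I r).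
have [c cm|g gE] := @quot_lift _ _ _ m f.
  by rewrite fE -linearZ; apply/quot_proj_eq0/mr.
have gi : injective g.
  apply: linear_inj => c'; have [c <-] := quot_proj_surj c'.
  rewrite gE fE -linearZ => /quot_proj_eq0 cr; apply/quot_proj_eq0.
  apply: (@sub_maximal _ m nR muniq (colon I r)); last exact/mem_colon.
  by apply: contra rI => /mem_colon; rewrite scale1r.
have [N gN] := cokernel_exact gi.
apply: (ext_vanishes_left Einj exactS gN _ vI).
by apply: vn1 => //; exact/fg_quot/fg_cyclic.
Qed.

Section Frobenius.
Variables (p : nat) (charR : prime_char p R) (e : nat).
Local Notation F := (frobenius_pushforward charR e).
Hypothesis Ffg : finitely_generated (F : lmodType R).

Lemma frobenius_ideal_closed (I : ideal R) a (x y : F) :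
  (x : R) \in I -> (y : R) \in I -> (a *: x + y : R) \in I.
Proof. by move=> xI yI; exact: (@submod_lin _ R^o I (a ^+ (p ^ e)) x y). Qed.

Definition frobenius_ideal (I : ideal R) : submodClosed (F : lmodType R) :=
  @submod_of R F (fun x => (x : R) \in I) (rpred0 I)
    (@frobenius_ideal_closed I).

Lemma mem_frobenius_ideal (I : ideal R) (x : F) :
  x \in frobenius_ideal I <-> (x : R) \in I.
Proof. exact: mem_submod_of. Qed.

(** The indices of vanishing are shifted by one: the assumptions say that
    n + 1 is the top degree in which Ext(-, R) is nonzero on finitely generated
    modules. The chain of ideals therefore has n + 1 steps, and its last member
    would have a nonzero Ext in degree at least n + 2. *)
Lemma ext_vanishes_frobenius_step n : ext_vanishes_from n.+1 ->
  ~ ext_vanishes_from n -> forall i, ext_vanishes i (F : lmodType R).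
Proof.
move=> vn1 nvn s; apply: contrapT => nvs.
have nvm : ~ ext_vanishes n (quot_module m).
  by move/(ext_vanishes_residue vn1).
have chain j : (j <= n.+1)%N -> exists2 I : ideal R,
    forall i, (j <= i)%N -> ext_vanishes i (quot_module I) &
    ~ ext_vanishes (s + j) (quot_module (frobenius_ideal I)).
  elim: j => [_|j IHj jn].
    have [x|f fE] := @quot_lift _ _ _ (span_submod [::])
      (idfun : {linear R^o -> R^o}).
      by move=> /mem_span_submod.
    exists (span_submod [::]) => [i _|].
      have : ext_vanishes i (R^o : lmodType R).
        apply: ext_vanishes_projective; first exact: exactS.
        exact: projective_regular.
      apply: (ext_vanishes_retract (f := f) (g := quot_proj _)) => y.
      by have [x <-] := quot_proj_surj y; rewrite fE.
    rewrite addn0 => vs; apply: nvs.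
    have [x|g gE] := @quot_lift _ _ _ (frobenius_ideal (span_submod [::]))
      (idfun : {linear F -> F}).
      by move=> /mem_frobenius_ideal/mem_span_submod.
    exact: (ext_vanishes_retract (f := quot_proj _) (g := g) gE vs).
  have [I vI nvI] := IHj (ltnW jn).
  have [r mr|x xm xreg] := @exists_regular_element _ m nR I.
    have [//|rI] := boolP (r \in I); case: nvm.
    by apply: ext_vanishes_socle vn1 _ rI mr; exact: vI.
  (* One ideal serves both modules: multiplication by x on F is multiplication
     by y on the underlying ring. *)
  pose y := x ^+ (p ^ e).
  have ym : y \in m.
    have pe : (0 < p ^ e)%N by rewrite expn_gt0 prime_gt0 //; case/andP: charR.
    by rewrite /y -(prednK pe) exprSr; exact: ideal_mul.
  have yreg (z : R^o) : z \in I <-> y *: z \in I.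
    split=> [zI|]; first exact: rpredZ.
    rewrite /y; elim: (p ^ e)%N => [|k IHk]; first by rewrite scale1r.
    by rewrite exprS -scalerA => /xreg.
  have adjE (z : R^o) : z \in adjoin I (y : R^o) <->
      exists t : R^o, z - y *: t \in I.
    by rewrite mem_adjoin; split=> -[c cJ]; exists c;
       rewrite [_ *: _](mulrC _ _).
  exists (adjoin I (y : R^o)) => [[//|i] ji|].
    have [f [g [fg _]]] := quot_scale_exact yreg adjE.
    by apply: (ext_vanishes_right Einj exactS fg); apply: vI => //; exact: leqW.
  have Freg (z : F) : z \in frobenius_ideal I <-> x *: z \in frobenius_ideal I.
    by rewrite !mem_frobenius_ideal; exact: yreg.
  have FadjE (z : F) : z \in frobenius_ideal (adjoin I (y : R^o)) <->
      exists t : F, z - x *: t \in frobenius_ideal I.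
    rewrite mem_frobenius_ideal.
    split=> [/adjE[t tI]|[t /mem_frobenius_ideal tI]].
      by exists t; apply/mem_frobenius_ideal.
    by apply/adjE; exists t.
  have [f [g [fg fE]]] := quot_scale_exact Freg FadjE.
  rewrite addnS; apply: contra_not nvI.
  apply: (ext_vanishes_regular Einj coaug_inj exact0 exactS nR
    mmax muniq xm _ _ fg).
    by move=> z'; have [z <-] := quot_proj_surj z'; rewrite fE linearZ.
  exact: fg_quot.
have [I _ []] := chain _ (leqnn _).
by apply: vn1; [exact: fg_quot|exact: leq_addl].
Qed.

Lemma ext_vanishes_frobenius n : ext_vanishes_from n ->
  forall i, ext_vanishes i (F : lmodType R).
Proof.
elim: n => [|n IHn] vn; first by move=> i; exact: vn.
have [/IHn//|] := pselect (ext_vanishes_from n).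
exact: ext_vanishes_frobenius_step.
Qed.

End Frobenius.
End Vanishing.

(** * Projective modules have a dual basis *)

Section DualBasis.
Variables (R : comPzRingType) (P : lmodType R).

(** c describes the finite formal sum of c y times y over y in s. *)
Definition supported (c : P -> R^o) (s : seq P) :=
  uniq s /\ forall y, y \notin s -> c y = 0.

(** The sum depends on c alone: only the y with c y nonzero contribute. *)
Lemma supported_sum (c : P -> R^o) s t : supported c s -> supported c t ->
  \sum_(y <- s) c y *: y = \sum_(y <- t) c y *: y.
Proof.
have nonzero u : \sum_(y <- u) c y *: y
    = \sum_(y <- [seq y <- u | c y != 0]) c y *: y.
  rewrite big_filter (bigID (fun y => c y != 0)) /= [X in _ + X]big1 ?addr0 //.
  by move=> y /negPn/eqP ->; rewrite scale0r.
move=> [us cs] [ut ct]; rewrite nonzero [RHS]nonzero; apply: perm_big.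
apply: uniq_perm; rewrite ?filter_uniq // => y; rewrite !mem_filter.
have [//|cy /=] := eqVneq (c y) 0.
have -> : y \in s by apply: contraNT cy => /cs ->.
by apply/esym; apply: contraNT cy => /ct ->.
Qed.

Lemma supported_cat (c c' : P -> R^o) s t : supported c s -> supported c' t ->
  supported c (undup (s ++ t)) /\ supported c' (undup (s ++ t)).
Proof.
move=> [_ cs] [_ ct]; split; split=> [|y]; rewrite ?undup_uniq //;
  by rewrite mem_undup mem_cat negb_or => /andP[ys yt]; auto.
Qed.

(** The finitely supported functions on P form the free module on P, which maps
    onto P; the coordinates of a section of this map form the dual basis. *)
Lemma dual_basis : projective P -> exists c : P -> {linear P -> R^o},
  forall x, exists2 s, supported (c^~ x) s & x = \sum_(y <- s) c y x *: y.
Proof.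
move=> Pp; pose S (f : P -> R^o) := exists s, supported f s.
have S0 : S 0 by exists [::].
have SD a f g : S f -> S g -> S (a *: f + g).
  move=> [s fs] [t gt]; exists (undup (s ++ t)).
  have [[u fu] [_ gu]] := supported_cat fs gt; split=> // y yu.
  by rewrite -[LHS]/(a *: f y + g y) fu // gu // scaler0 addr0.
pose Phi := submodule (submod_of S0 SD).
have PhiS (f : Phi) : S (sub_incl f) by have /mem_submod_of := sub_incl_mem f.
have [supp suppP] := choice PhiS.
have [eps epsE] : exists eps : {linear Phi -> P},
    forall f, eps f = \sum_(y <- supp f) sub_incl f y *: y.
  apply: linear_ex => a f g; rewrite linearP.
  have [fu gu] := supported_cat (suppP f) (suppP g).
  rewrite (supported_sum (suppP f) fu) (supported_sum (suppP g) gu).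
  have afg := suppP (a *: f + g); rewrite linearP in afg.
  have [u fu0] := fu; have [_ gu0] := gu.
  rewrite (@supported_sum _ _ (undup (supp f ++ supp g)) afg); last first.
    split=> // y yu; rewrite -[LHS]/(a *: sub_incl f y + sub_incl g y).
    by rewrite fu0 // gu0 // scaler0 addr0.
  rewrite scaler_sumr -big_split; apply: eq_bigr => y _ /=.
  by rewrite scalerA -scalerDl.
have eps_surj : surjective eps.
  move=> x; pose f (y : P) : R^o := (y == x)%:R.
  have fx : supported f [:: x].
    by split=> // y; rewrite inE /f => /negbTE ->.
  have [|g gE] := @sub_incl_surj _ _ (submod_of S0 SD) f.
    by apply/mem_submod_of; exists [:: x].
  exists g; rewrite epsE gE (@supported_sum _ _ [:: x] _ fx).
    by rewrite big_seq1 /f eqxx scale1r.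
  by rewrite -gE.
have [h hE] := Pp _ _ eps idfun eps_surj.
suff /choice[c cE] y : exists c : {linear P -> R^o},
    forall x, c x = sub_incl (h x) y.
  exists c => x; exists (supp (h x)).
    by rewrite (_ : (fun y => c y x) = sub_incl (h x)) //; apply/funext.
  by rewrite -[x in LHS]hE epsE; apply: eq_bigr => y _; rewrite cE.
by apply: linear_ex => a x x'; rewrite !linearP.
Qed.

End DualBasis.

(** * Finiteness of all Frobenius pushforwards *)

Section FrobeniusFinite.
Variables (p : nat) (R : comPzRingType) (charR : prime_char p R).
Local Notation F e := (frobenius_pushforward charR e : lmodType R).

(** The action of r on F^b is that of r ^ (p ^ (b - a)) on F^a. *)
Lemma frobenius_fg_le a b : (a <= b)%N ->
  finitely_generated (F b) -> finitely_generated (F a).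
Proof.
move=> ab [s sF]; exists s => x; have : in_span (s : seq (F b)) x := sF x.
elim: s x {sF} => //= g s IHs x [c /IHs sx]; exists (c ^+ (p ^ (b - a))).
rewrite [X in in_span _ X](_ : _ = x - c *: (g : F b)) //.
congr (x - _); rewrite /GRing.scale /= /frobenius_scale.
by rewrite -exprM -expnD subnK.
Qed.

(** If the g generate F^b and the h generate F^a, then the h ^ (p ^ b) * g
    generate F^(a + b). *)
Lemma frobenius_fg_add a b :
  finitely_generated (F a) -> finitely_generated (F b) ->
  finitely_generated (F (a + b)).
Proof.
move=> [t tF] [s sF].
pose u : seq (F (a + b)) :=
  flatten [seq [seq (h : R) ^+ (p ^ b) * (g : R) | h <- t] | g <- s].
exists u => x; have : in_span (s : seq (F b)) x := sF x.
have su g : g \in (s : seq R) -> forall c : R, in_span u (c ^+ (p ^ b) * g : R).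
  move=> gs; pose Q (c : F a) := in_span u ((c : R) ^+ (p ^ b) * g : R).
  have Q0 : Q 0.
    have [p_pr _] := andP charR.
    rewrite /Q expr0n expn_eq0 /= eqn0Ngt prime_gt0 // mul0r.
    exact: in_span0.
  have QD r c c' : Q c -> Q c' -> Q (r *: c + c').
    move=> Qc Qc'; rewrite /Q (exprDn_prime_char charR) mulrDl.
    rewrite exprMn -exprM -expnD -mulrA.
    by have := in_span_lin r Qc Qc'.
  move=> c; apply/(mem_submod_of Q0 QD); apply: in_span_min (tF c) => h ht.
  apply/mem_submod_of; apply: in_span_mem; apply/flattenP.
  exists [seq (h : R) ^+ (p ^ b) * (g : R) | h <- t]; last exact: map_f.
  exact: (map_f (fun g => [seq (h : R) ^+ (p ^ b) * (g : R) | h <- t])).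
have : {subset (s : seq R) <= (s : seq R)} by [].
elim: {1 3}s x => /= [|g s' IHs] x ss.
  by move=> ->; exact: in_span0.
case=> c /IHs sx.
have -> : x = 1 *: (x - c *: (g : F b) : F (a + b)) + (c ^+ (p ^ b) * g : R)
    :> F (a + b).
  by rewrite scale1r; exact/esym/(subrK (c *: (g : F b)) x).
apply: in_span_lin; first by apply: sx => h hs; apply: ss; rewrite inE hs orbT.
by apply: su; apply: ss; rewrite mem_head.
Qed.

(** Finiteness for one exponent a > 0 gives it for the multiples of a, which
    exceed any given exponent. *)
Lemma frobenius_fg e : F_finite charR -> finitely_generated (F e).
Proof.
move=> [a a0 /finite_module_fg Fa].
apply: (@frobenius_fg_le e (a * e.+1)).
  by apply: leq_trans (leqnSn e) _; rewrite leq_pmull.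
elim: e => [|e IHe]; first by rewrite muln1.
by rewrite mulnS; exact: frobenius_fg_add.
Qed.

End FrobeniusFinite.

(** * Lifting through a finite projective resolution *)

Section Lifting.
Variables (R : comPzRingType) (E : nat -> lmodType R).
Variables (d : forall i, {linear E i -> E i.+1}).
Variables (coaug : {linear R^o -> E 0%N}).
Hypotheses (Einj : forall i, injective_module (E i)).
Hypotheses (coaug_inj : injective coaug) (exact0 : exact coaug (d 0%N)).
Hypothesis (exactS : forall i, exact (d i) (d i.+1)).
Hypothesis nR : noetherian R.
Local Notation ext_vanishes := (ext_vanishes d).
Implicit Types A B C M N : lmodType R.

(** The image of u is finitely generated, so only finitely many coordinates of a
    dual basis of P are nonzero on it; each is a map to R, so it extends. *)
Lemma extend_to_projective A B C (f : {linear A -> B}) (g : {linear B -> C})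
    (P : lmodType R) (u : {linear A -> P}) :
    short_exact f g -> ext_vanishes 0 C -> finitely_generated A ->
    projective P ->
  exists v : {linear B -> P}, forall x, v (f x) = u x.
Proof.
move=> fg vC [s sA] /dual_basis[c cP].
have [t [ut tu]] : exists t : seq P, uniq t /\
    forall y, y \notin t -> forall x, c y (u x) = 0.
  have [t ts] : exists t : seq P, forall y, y \notin t ->
      forall x, x \in s -> c y (u x) = 0.
    elim: s {sA} => [|a s [t ts]]; first by exists [::].
    have [r [_ cr] _] := cP (u a); exists (r ++ t) => y.
    rewrite mem_cat negb_or => /andP[yr yt] x.
    by rewrite inE => /predU1P[->|/(ts y yt)//]; exact: cr.
  exists (undup t); split=> [|y]; first exact: undup_uniq.
  rewrite mem_undup => /ts cs x; apply/(mem_kernel (c y \o u)).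
  by apply: in_span_min (sA x) => z /cs zs; apply/mem_kernel.
have /choice[w wE] y : exists w : {linear B -> R^o},
    forall x, w (f x) = c y (u x).
  exact: (linear_extend Einj coaug_inj exact0 exactS (c y \o u) fg vC).
have [v vE] : exists v : {linear B -> P},
    forall x, v x = \sum_(y <- t) w y x *: y.
  apply: linear_ex => a x z; rewrite scaler_sumr -big_split.
  by apply: eq_bigr => y _ /=; rewrite linearP scalerDl scalerA.
exists v => x; rewrite vE (eq_bigr (fun y => c y (u x) *: y)); last first.
  by move=> y _; rewrite wE.
have [s' cs' {2}->] := cP (u x); apply: (supported_sum _ cs').
by split=> // y /tu.
Qed.

(** Over a Gorenstein local ring these are 0 and the maximal Cohen-Macaulay
    modules; what matters is that the class is closed under syzygies. *)
Definition ext_acyclic M := finitely_generated M /\ forall i, ext_vanishes i M.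

Lemma ext_acyclic_syzygy M : ext_acyclic M ->
  exists A (F : lmodType R) (f : {linear A -> F}) (g : {linear F -> M}),
    [/\ short_exact f g, projective F & ext_acyclic A].
Proof.
move=> [Mfg vM]; have [F [g [Fp Ffg gs]]] := projective_cover Mfg.
have fg := short_exact_kernel gs.
exists (submodule (kernel g)), F, sub_incl, g; split=> //; split=> [|i].
  exact: (noetherian_fg_sub nR (@sub_incl_inj _ _ _) Ffg).
apply: (ext_vanishes_left Einj exactS fg); first exact: vM.
exact: (ext_vanishes_projective exactS Fp).
Qed.

(** Descending induction on i, starting where P i = 0. Cover M by a projective F
    with syzygy A. The map h lifts to w : F -> P i, and w maps A to the kernel
    of pi, which is covered by P (i+1). By induction A -> ker pi lifts to
    P (i+1), this lift extends to F because Ext^1(M, R) = 0, and subtracting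
    its image in P i from w gives a map that descends to M. *)
Lemma lift_through_resolution n (P : nat -> lmodType R)
    (dP : forall i, {linear P i.+1 -> P i}) :
    (forall i, projective (P i)) ->
    (forall i, (n < i)%N -> zero_module (P i)) ->
    (forall i, exact (dP i.+1) (dP i)) ->
  forall i N (pi : {linear P i -> N}), surjective pi -> exact (dP i) pi ->
    forall M (h : {linear M -> N}), ext_acyclic M ->
    exists h' : {linear M -> P i}, forall x, pi (h' x) = h x.
Proof.
move=> Pp P0 dPx i; have [k] := ubnP (n.+1 - i)%N.
elim: k i => // k IHk i ki N pi pis pix M h Mac.
have [ni|ni] := ltnP n i.
  exists \0 => x; have [y <-] := pis (h x).
  by rewrite (P0 _ ni y).
have [A [F [f [g [fg Fp Aac]]]]] := ext_acyclic_syzygy Mac.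
have [w wE] := Fp _ _ pi (h \o g) pis.
have [w' w'E] : exists w' : {linear A -> submodule (kernel pi)},
    forall x, sub_incl (w' x) = w (f x).
  apply: (factor_inj (h := w \o f)) => [|x]; first exact: sub_incl_inj.
  apply/sub_incl_surj/mem_kernel.
  by rewrite /= wE /= (short_exact_comp0 fg) linear0.
have [pi' pi'E] : exists pi' : {linear P i.+1 -> submodule (kernel pi)},
    forall x, sub_incl (pi' x) = dP i x.
  apply: factor_inj => [|x]; first exact: sub_incl_inj.
  by apply/sub_incl_surj/mem_kernel/pix; exists x.
have [|y|x|k0 k0E] := IHk i.+1 _ _ pi' _ _ A w' Aac.
- by move: ki; rewrite subSS ltnS subSn.
- have /mem_kernel/pix[x xy] := sub_incl_mem y.
  by exists x; apply: sub_incl_inj; rewrite pi'E.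
- rewrite -dPx -pi'E; split=> [->|]; first exact: linear0.
  by move=> e; apply: sub_incl_inj; rewrite e linear0.
have [k1 k1E] : exists k1 : {linear F -> P i.+1}, forall x, k1 (f x) = k0 x.
  apply: (extend_to_projective k0 fg) => //; first by case: Mac.
  by case: Aac.
have [x|h' h'E] := factor_cokernel fg (b := w \- (dP i \o k1)).
  by rewrite /= k1E -pi'E k0E w'E subrr.
exists h' => x; have [_ _ /(_ x)[y <-]] := fg.
rewrite h'E linearB wE /=.
have -> : pi (dP i (k1 y)) = 0 by apply/pix; exists (k1 y).
by rewrite subr0.
Qed.

End Lifting.

(** * Lifting Frobenius maps *)

Theorem theorem3 (p : nat) (R : comPzRingType) (charR : prime_char p R)
    (RG : gorenstein_local_ring R) (RF : F_finite charR)
    (Q : ideal R) (Qpd : finite_projective_dimension (ideal_quotient Q))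
    (e : nat) (e_gt0 : (0 < e)%N)
    (phi : {linear frobenius_pushforward (quot_prime_char Q charR) e
                   -> (ideal_quotient Q)^o}) :
  exists phit : {linear frobenius_pushforward charR e -> R^o},
    forall x : frobenius_pushforward charR e,
      quot_map Q (phit x)
      = phi (frobenius_map charR (quot_prime_char Q charR) e (quot_map Q) x).
Proof.
have [nR [m [mmax muniq]] [n [E [d [coaug [Einj E0 ci exact0 exactS]]]]]] := RG.
have Ffg := frobenius_fg e RF.
have Fac : ext_acyclic d (frobenius_pushforward charR e : lmodType R).
  split=> //.
  apply: (ext_vanishes_frobenius Einj ci exact0 exactS nR mmax muniq Ffg
    (n := n)).
  move=> M _ i ni g _; exists \0 => x.
  by rewrite linear0 (E0 _ _ (g x)).
have [k [P [dP [aug [Pp P0 augs augx dPx]]]]] := Qpd.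
pose Fpi := frobenius_map charR (quot_prime_char Q charR) e (quot_map Q).
have [h hE] : exists h : {linear frobenius_pushforward charR e
                                   -> ideal_quotient Q},
    forall x, h x = phi (Fpi x).
  apply: linear_ex => a x y.
  transitivity (phi (quot_map Q a *: Fpi x + Fpi y)).
    congr (phi _); rewrite /Fpi /frobenius_map /GRing.scale /= /frobenius_scale.
    by rewrite -rmorphXn -rmorphM -rmorphD.
  by rewrite linearP.
have [h' h'E] := lift_through_resolution Einj ci exact0 exactS nR Pp P0 dPx
  augs augx h Fac.
have [q qE] : exists q : {linear R^o -> ideal_quotient Q},
    forall x, q x = quot_map Q x.
  by apply: linear_ex => a x y; rewrite raddfD; congr (_ + _); exact: rmorphM.
have [x|g gE] := Pp 0%N _ _ q aug.
  by have [r rE] := quot_map_surj x; exists r; rewrite qE.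
by exists (g \o h') => x; rewrite -qE /= gE h'E hE.
Qed.
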